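(* Let $0 \le s \le \frac{d_h}{2d_w}$ and let $X_s$ be a FGF with parameter $s$. Then $X_s$ a.s. belongs to $H^{-\alpha}(K)$ for every $\alpha > \frac{d_h}{d_w}-2s$. More precisely, for every $\alpha > \frac{d_h}{d_w}-2s$, the series \[ \sum_{j=1}^{\infty} \lambda_j^{-\alpha} X_s (\Phi_j)^2 \] is a.s. convergent.
   Context: Let $p_1,p_2,p_3\in\mathbb C$ be the vertices of an equilateral triangle of side $1$, $V_0=\{p_1,p_2,p_3\}$, $\mathfrak f_i(z)=\frac{z-p_i}{2}+p_i$ ($i=1,2,3$). $K$ is the Sierpinski gasket: the unique non-empty compact set with $K=\bigcup_{i=1}^3\mathfrak f_i(K)$; its boundary is $\partial K=V_0$. $d_h=\frac{\ln3}{\ln2}$, $d_w=\frac{\ln5}{\ln2}$. $\mu$ is the Borel measure on $K$ with $\mu(\mathfrak f_{i_1}\circ\cdots\circ\mathfrak f_{i_n}(K))=3^{-n}$ for all $n$ and all $i_1,\dots,i_n\in\{1,2,3\}$. Put $V_{m+1}=\bigcup_{i}\mathfrak f_i(V_m)$; $x\sim y$ in the graph $G_m$ on $V_m$ means that $x\neq y$ both belong to a common set $\mathfrak f_{i_1}\circ\cdots\circ\mathfrak f_{i_m}(V_0)$ (edges have length $2^{-m}$). Let $a_m=\frac{3^{m+1}}2$, $\mathcal E_m(f,f)=\frac{5^m}{a_m}\sum_{x,y\in V_m,\,x\sim y}(f(x)-f(y))^2$ (each edge counted once), $\mathcal E(f,f)=\lim_m\mathcal E_m(f,f)$ (a non-decreasing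 limit), $\mathcal F_0=\{f\in C(K):\mathcal E(f,f)<\infty,\ f=0\text{ on }\partial K\}$. $(\mathcal E,\mathcal F_0)$ is a local regular Dirichlet form on $L^2(K,\mu)$; the Dirichlet Laplacian $\Delta$ is its (self-adjoint, nonpositive) generator: $\mathcal E(f,g)=-\int_K\Delta f\,g\,d\mu$. Let $0<\lambda_1\le\lambda_2\le\cdots$ be the eigenvalues of $-\Delta$ (with multiplicity) and $(\Phi_j)_{j\ge1}$ an orthonormal basis of $L^2(K,\mu)$ of continuous eigenfunctions, $\Delta\Phi_j=-\lambda_j\Phi_j$. For $s\ge0$, $f\in L^2(K,\mu)$: $(-\Delta)^{-s}f=\sum_j\lambda_j^{-s}\Phi_j\int_K\Phi_jf\,d\mu$; and $(-\Delta)^{s}f=\sum_j\lambda_j^{s}\Phi_j\int_K\Phi_jf\,d\mu$ when $\sum_j\lambda_j^{2s}(\int_K\Phi_jf\,d\mu)^2<\infty$. $\mathcal S(K)$ is the set of $f\in C(K)$ vanishing on $\partial K$ with $\lim_{n\to\infty}n^k|\int_K\Phi_nf\,d\mu|=0$ for all $k\ge0$, with the topology of the norms $\|f\|_k=\|(-\Delta)^kf\|_{L^2(K,\mu)}$, $k=0,1,2,\dots$; $\mathcal S'(K)$ is its topological dual. FGF with parameter $s\ge0$: a centered Gaussian random variable $X_s$ with values in $\mathcal S'(K)$ with $\mathbb E(X_s(f)X_s(g))=\int_K(-\Delta)^{-s}f\,(-\Delta)^{-s}g\,d\mu$ for $f,g\in\mathcal S(K)$. Sobolev spaces: for $\alpha\ge0$,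 $H^\alpha(K)$ is the closure of $\mathcal S(K)$ for the norm $\|f\|_{H^\alpha(K)}^2=\sum_j\lambda_j^\alpha(\int_Kf\Phi_j\,d\mu)^2$, and $H^{-\alpha}(K)\subset\mathcal S'(K)$ is the dual of $H^\alpha(K)$ in the distributional sense, whose norm is $\|\psi\|_{H^{-\alpha}(K)}^2=\sum_j\lambda_j^{-\alpha}\psi(\Phi_j)^2$. *)

(* Defs.v *)
From HB Require Import structures.
From mathcomp Require Import all_boot all_order all_algebra.
From mathcomp Require Import complex.
From mathcomp Require Import all_classical all_reals all_analysis.

Set Implicit Arguments.
Unset Strict Implicit.
Unset Printing Implicit Defensive.

Import Order.TTheory GRing.Theory Num.Theory.
Import numFieldNormedType.Exports.

Local Open Scope classical_set_scope.
Local Open Scope complex_scope.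
Local Open Scope ring_scope.

(* R[i]^o is the complex plane R[i] with the topology of its modulus. *)
Notation plane R := (R[i]^o).

Definition contraction (R : realType) (p : 'I_3 -> plane R) (i : 'I_3)
    (z : plane R) : plane R :=
  (z - p i) / 2 + p i.

Record gasket (R : realType) := Gasket {
  vertex : 'I_3 -> plane R ;
  vertex_dist : forall i j, i != j -> `|vertex i - vertex j| = 1 ;
  carrier : set (plane R) ;
  carrier_nonempty : carrier !=set0 ;
  carrier_compact : compact carrier ;
  carrier_selfsimilar :
    carrier = \bigcup_(i : 'I_3) (contraction vertex i @` carrier) }.

(* The points of the gasket, as a type: C(K) is the set of continuous
   K G -> R, and L^2(K, mu) is Lfun mu 2. *)
Definition K (R : realType) (G : gasket R) : Type := set_type (carrier G).

Section gasket_type.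
Context {R : realType} (G : gasket R).

HB.instance Definition _ := SubType.copy (K G) (set_type (carrier G)).
HB.instance Definition _ := Choice.copy (K G) (set_type (carrier G)).
HB.instance Definition _ := Topological.copy (K G) (set_type (carrier G)).

Lemma K_inhabited : {x : plane R | x \in carrier G}.
Proof. by have /cid[x Gx] := carrier_nonempty G; exists x; rewrite inE. Qed.

HB.instance Definition _ := isPointed.Build (K G) K_inhabited.

(* Borel sigma-algebra *)
HB.instance Definition _ :=
  Measurable.copy (K G) (g_sigma_algebraType (@open (K G))).

End gasket_type.

Section analysis_on_the_gasket.
Context {R : realType} (G : gasket R).
Implicit Types (f g h u : K G -> R) (m n k : nat) (r a : R).

Definition d_h : R := ln 3 / ln 2.
Definition d_w : R := ln 5 / ln 2.

(* f_{i_1} \o ... \o f_{i_n} for the word w = i_1 ... i_n *)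
Definition word_map n (w : n.-tuple 'I_3) (z : plane R) : plane R :=
  foldr (contraction (vertex G)) z w.

Definition cell n (w : n.-tuple 'I_3) : set (K G) :=
  [set x | (word_map w @` carrier G) (val x)].

Definition selfsimilar_measure (mu : {measure set (K G) -> \bar R}) : Prop :=
  forall n (w : n.-tuple 'I_3), mu (cell w) = (3 ^- n)%:E.

Fixpoint vertices m : set (plane R) :=
  if m is m'.+1 then \bigcup_(i : 'I_3) (contraction (vertex G) i @` vertices m')
  else range (vertex G).

Definition adjacent m (x y : plane R) : Prop :=
  x != y /\ exists w : m.-tuple 'I_3,
    (word_map w @` vertices 0) x /\ (word_map w @` vertices 0) y.

Definition arcs m : set (K G * K G) :=
  [set e | [/\ vertices m (val e.1), vertices m (val e.2) &
    adjacent m (val e.1) (val e.2)]].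

(* Every edge gives two arcs, whence the factor 1/2. *)
Definition energy_at m f : R :=
  5 ^+ m / (3 ^+ m.+1 / 2) *
  (2^-1 * \sum_(e \in arcs m) (f e.1 - f e.2) ^+ 2).

Definition energy f : \bar R := limn (fun m => (energy_at m f)%:E).

(* E(f, g), by polarization *)
Definition form f g : R :=
  (fine (energy (fun x => f x + g x)) - fine (energy (fun x => f x - g x))) / 4.

Definition vanishes_on_boundary f : Prop :=
  forall x : K G, range (vertex G) (val x) -> f x = 0.

Definition F0 : set (K G -> R) :=
  [set f | [/\ continuous f, (energy f < +oo)%E & vanishes_on_boundary f]].

Variable mu : {measure set (K G) -> \bar R}.

Definition ip f g : R := Rintegral mu setT (fun x => f x * g x).

Definition L2norm f : \bar R := 'N[mu]_2%:E[EFin \o f].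

Definition L2cvg (u_ : nat -> K G -> R) f : Prop :=
  (fun n => L2norm (fun x => u_ n x - f x)) @ \oo --> 0%E.

(* u is in the domain of the generator of (E, F0) on L^2(K, mu), and
   Delta u = h; u is the continuous representative of its class. *)
Definition dirichlet_laplacian u h : Prop :=
  [/\ F0 u, h \in Lfun mu 2%:E & forall g, F0 g -> form u g = - ip h g].

(* lam j and Phi j are lambda_{j+1} and Phi_{j+1}; as Phi is a Hilbert basis,
   lam lists all the eigenvalues, with their multiplicities. *)
Record eigenbasis (lam : nat -> R) (Phi : nat -> K G -> R) : Prop := {
  eigenvalue_gt0 : forall j, 0 < lam j ;
  eigenvalue_nondecreasing : forall i j, (i <= j)%N -> lam i <= lam j ;
  eigenfunction_continuous : forall j, continuous (Phi j) ;
  eigenfunctionP :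
    forall j, dirichlet_laplacian (Phi j) (fun x => - lam j * Phi j x) ;
  eigenfunction_orthonormal : forall i j, ip (Phi i) (Phi j) = (i == j)%:R ;
  eigenfunction_total : forall f, f \in Lfun mu 2%:E ->
    L2cvg (fun n x => \sum_(j < n) ip (Phi j) f * Phi j x) f }.

Variables (lam : nat -> R) (Phi : nat -> K G -> R).

(* (- Delta)^r f, for r of any sign: a representative of the sum of its
   L^2-convergent series (and the zero function if the series diverges) *)
Definition laplacian_pow r f : K G -> R :=
  xget (cst 0) [set h | h \in Lfun mu 2%:E /\
    L2cvg (fun n x => \sum_(j < n) lam j `^ r * ip (Phi j) f * Phi j x) h].

Definition schwartz : set (K G -> R) :=
  [set f | [/\ continuous f, vanishes_on_boundary f &
    forall k, (fun j => j.+1%:R ^+ k * `|ip (Phi j) f|) @ \oo --> (0 : R)]].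

Definition schwartz_norm k f : R := fine (L2norm (laplacian_pow k%:R f)).

Definition linear_on (D : set (K G -> R)) (T : (K G -> R) -> R) : Prop :=
  forall c f g, D f -> D g -> T (fun x => c * f x + g x) = c * T f + T g.

(* S'(K): only the values on S(K) of such a functional are meaningful. The
   topology of S(K) is generated by the balls of all the norms ||.||_k. *)
Definition schwartz_dual : set ((K G -> R) -> R) :=
  [set T | linear_on schwartz T /\
    forall f, schwartz f -> forall e : R, 0 < e ->
    exists n (d : R), 0 < d /\
    forall g, schwartz g ->
      (forall k, (k < n)%N -> schwartz_norm k (fun x => g x - f x) < d) ->
    `|T g - T f| < e].

Definition sobolev_norm2 a f : \bar R :=
  (\sum_(0 <= j <oo) (lam j `^ a * (ip f (Phi j)) ^+ 2)%:E)%E.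

(* H^a(K) for a >= 0; as lam is bounded below, its norm dominates that of L^2 *)
Definition sobolev a : set (K G -> R) :=
  [set f | f \in Lfun mu 2%:E /\ forall e : R, 0 < e ->
    exists2 g, schwartz g & (sobolev_norm2 a (fun x => (g x - f x)%R) < e%:E)%E].

(* H^{-a}(K) for a >= 0: the distributions that are the restriction to S(K) of a
   continuous linear functional on H^a(K) *)
Definition sobolev_dual a : set ((K G -> R) -> R) :=
  [set T | schwartz_dual T /\ exists L : (K G -> R) -> R,
    [/\ linear_on (sobolev a) L,
        forall f, sobolev a f -> forall e : R, 0 < e ->
          exists d : R, 0 < d /\ forall g, sobolev a g ->
          (sobolev_norm2 a (fun x => (g x - f x)%R) < d%:E)%E -> `|L g - L f| < e &
        forall f, schwartz f -> T f = L f]].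

(* The normal law N(0, sigma ^ 2), which is the Dirac mass at 0 if sigma = 0
   (normal_prob 0 0 is something else). *)
Definition centered_gaussian (dO : measure_display) (Omega : measurableType dO)
    (P : probability Omega R) (Y : Omega -> R) : Prop :=
  measurable_fun setT Y /\
  exists sigma : R, forall A : set (measurableTypeR R), measurable A ->
    P (Y @^-1` A) = if sigma == 0 then \d_(0 : R) A else normal_prob 0 sigma A.

(* X w is the distribution that X takes at w. The continuous linear functionals
   on S'(K) are the evaluations at the elements of S(K), so these have to be
   (measurable and) Gaussian. *)
Record FGF (dO : measure_display) (Omega : measurableType dO)
    (P : probability Omega R) (s : R) (X : Omega -> (K G -> R) -> R) : Prop := {
  FGF_dual : forall w, schwartz_dual (X w) ;
  FGF_gaussian : forall f, schwartz f -> centered_gaussian P (fun w => X w f) ;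
  FGF_covariance : forall f g, schwartz f -> schwartz g ->
    ('E_P[fun w => (X w f * X w g)%R] =
     (ip (laplacian_pow (- s) f) (laplacian_pow (- s) g))%:E)%E }.

End analysis_on_the_gasket.

Arguments d_h {R}.
Arguments d_w {R}.

(* Main.v *)
(** The coefficients X(Phi_j) are centered with variance lambda_j^(-2s), so the
    expectation of the series is the sum of the lambda_j^(-(alpha + 2s)), and
    everything reduces to the convergence of this sum when alpha + 2s > d_h / d_w,
    i.e. to the Weyl-type lower bound lambda_(3^m) >= c 5^m. For the latter, take a
    nonzero combination u of 3^m + 1 eigenfunctions which vanishes at one chosen
    vertex of each of the 3^m cells of level m. On such a cell, of measure 3^(-m),
    chaining along the edges of the finer graphs bounds the square of u by a multiple
    of (3/5)^m times the energy of u in the cell; hence the squared norm of u is at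
    most C 5^(-m) E(u, u), while E(u, u) is at most the largest eigenvalue times this
    squared norm. *)
From mathcomp Require Import all_boot all_order all_algebra.
From mathcomp Require Import complex ring lra.
From mathcomp Require Import all_classical all_reals all_analysis.
From mathcomp Require Import measurable_realfun.
Require Import Defs.
Set Implicit Arguments.
Unset Strict Implicit.
Unset Printing Implicit Defensive.

Import Order.TTheory GRing.Theory Num.Theory.
Import numFieldNormedType.Exports.

Local Open Scope classical_set_scope.
Local Open Scope ring_scope.

(** * Discrete energies on a self-similar set *)

(** The energies are sums over arcs, that is over sets of pairs of points, whereas self-similarity
    speaks of words. Passing from one to the other requires that an arc determine its cell and its
    two corners; the geometry of the equilateral triangle enters there, through barycentric
    coordinates. The chaining itself only uses that each map fixes its vertex and that any two maps
    share a junction point. The rate 5^m is the product of 3^m, from the measure of the cells, and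
    (5/3)^m, the factor which makes the discrete energies nondecreasing in the level. Two obstacles
    come after the convergence of the series. The null set must not depend on alpha, so countably
    many exponents have to suffice. And a convergent series defines a functional on the Sobolev
    space, which must then be shown to agree with the distribution on Schwartz functions: this rests
    on the convergence of the eigenfunction projections in every Schwartz norm, where the powers of
    the Laplacian are only chosen representatives of L^2 limits. *)

Lemma big_tuple_cons (V : nmodType) (I : finType) n (G : n.+1.-tuple I -> V) :
  \sum_w G w = \sum_i \sum_(w : n.-tuple I) G (cons_tuple i w).
Proof.
rewrite pair_big /= (reindex (fun p : I * n.-tuple I => cons_tuple p.1 p.2)) //.
exists (fun w => (thead w, behead_tuple w)) => [[i w] _|w _] /=.
  by congr pair; exact: val_inj.
by rewrite [RHS]tuple_eta; exact: val_inj.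
Qed.

Section selfsimilar_energy.
Context {R : realType} (T : Type) (F : 'I_3 -> T -> T) (v : 'I_3 -> T).
Hypothesis F_fix : forall i, F i (v i) = v i.
Hypothesis F_junction : forall i j, F i (v j) = F j (v i).
Implicit Types (f g h : T -> R).

Definition act (w : seq 'I_3) (x : T) : T := foldr F x w.

(** Ordered pairs count every edge twice, as arcs do; the diagonal terms vanish. *)
Definition boundary_form f g : R :=
  \sum_i \sum_j (f (v i) - f (v j)) * (g (v i) - g (v j)).

Fixpoint level_form n f g : R :=
  if n is n'.+1 then
    \sum_i level_form n' (fun x => f (F i x)) (fun x => g (F i x))
  else boundary_form f g.

Definition renormalized n f g : R := (5 / 3) ^+ n * level_form n f g.

Lemma level_form_cat m n f g : level_form (m + n) f g =
  \sum_(w : m.-tuple 'I_3)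
     level_form n (fun x => f (act w x)) (fun x => g (act w x)).
Proof.
elim: m f g => [|m IH] f g.
  rewrite (big_pred1 [tuple]) //= => w.
  by rewrite [w]tuple0 /= eqxx.
rewrite big_tuple_cons addSn /=; apply: eq_bigr => i _.
by rewrite IH.
Qed.

Lemma level_formE m f g : level_form m f g =
  \sum_(w : m.-tuple 'I_3) \sum_i \sum_j
     (f (act w (v i)) - f (act w (v j))) * (g (act w (v i)) - g (act w (v j))).
Proof. by rewrite -{1}[m]addn0 level_form_cat. Qed.

Lemma level_form_ge0 n f : 0 <= level_form n f f.
Proof.
rewrite level_formE; do 3!apply: sumr_ge0 => ? _.
exact: sqr_ge0.
Qed.

Lemma level_form_comb n c f g h :
  level_form n (fun x => c * f x + g x) h =
  c * level_form n f h + level_form n g h.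
Proof.
rewrite !level_formE mulr_sumr -big_split /=; apply: eq_bigr => w _.
rewrite mulr_sumr -big_split /=; apply: eq_bigr => i _.
rewrite mulr_sumr -big_split /=; apply: eq_bigr => j _.
by ring.
Qed.

Lemma level_formC n f g : level_form n f g = level_form n g f.
Proof. by rewrite !level_formE; do 3!apply: eq_bigr => ? _; rewrite mulrC. Qed.

Lemma level_form_sum n k (c : 'I_k -> R) (f_ : 'I_k -> T -> R) h :
  level_form n (fun x => \sum_(j < k) c j * f_ j x) h =
  \sum_(j < k) c j * level_form n (f_ j) h.
Proof.
elim: k c f_ => [|k IH] c f_.
  rewrite big_ord0 level_formE !big1 // => w _; rewrite big1// => i _.
  by rewrite big1// => j _; rewrite !big_ord0 subr0 mul0r.
rewrite big_ord_recl -IH -level_form_comb; congr level_form.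
by apply/funext => x; rewrite big_ord_recl.
Qed.

Lemma level_form_sum2 n k (c : 'I_k -> R) (f_ : 'I_k -> T -> R) :
  level_form n (fun x => \sum_(j < k) c j * f_ j x)
               (fun x => \sum_(j < k) c j * f_ j x) =
  \sum_(i < k) \sum_(j < k) c i * c j * level_form n (f_ i) (f_ j).
Proof.
rewrite level_form_sum; apply: eq_bigr => i _.
rewrite level_formC level_form_sum mulr_sumr; apply: eq_bigr => j _.
by rewrite mulrA level_formC.
Qed.

Lemma level_form_polarization n f g :
  level_form n (fun x => f x + g x) (fun x => f x + g x) -
  level_form n (fun x => f x - g x) (fun x => f x - g x) =
  4 * level_form n f g.
Proof.
rewrite !level_formE -sumrN -big_split mulr_sumr; apply: eq_bigr => w _ /=.
rewrite -sumrN -big_split mulr_sumr; apply: eq_bigr => i _ /=.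
rewrite -sumrN -big_split mulr_sumr; apply: eq_bigr => j _ /=.
by ring.
Qed.

Lemma level_form_parallelogram n f g :
  level_form n (fun x => f x + g x) (fun x => f x + g x) +
  level_form n (fun x => f x - g x) (fun x => f x - g x) =
  2 * (level_form n f f + level_form n g g).
Proof.
rewrite !level_formE -!big_split mulr_sumr; apply: eq_bigr => w _ /=.
rewrite -!big_split mulr_sumr; apply: eq_bigr => i _ /=.
rewrite -!big_split mulr_sumr; apply: eq_bigr => j _ /=.
by ring.
Qed.

(* Among the extensions of three boundary values to the three junction points,
   the harmonic one (the weights 2/5, 2/5, 1/5) multiplies the energy by 3/5;
   the squares below measure the distance to it. *)
Lemma boundary_form_le f :
  boundary_form f f <= 5 / 3 * level_form 1 f f.
Proof.
rewrite /= /boundary_form.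
pose i0 : 'I_3 := ord0.
pose i1 : 'I_3 := lift ord0 ord0.
pose i2 : 'I_3 := lift ord0 (lift ord0 ord0).
have e3 (H : 'I_3 -> R) : \sum_i H i = H i0 + H i1 + H i2.
  by rewrite !big_ord_recl big_ord0 addr0 addrA.
rewrite !e3 !F_fix (F_junction i1 i0) (F_junction i2 i0) (F_junction i2 i1).
move: (f (v i0)) (f (v i1)) (f (v i2)) => a b c.
move: (f (F i0 (v i1))) (f (F i0 (v i2))) (f (F i1 (v i2))) => x y z.
pose p := x - (2 * a + 2 * b + c) / 5.
pose q := y - (2 * a + 2 * c + b) / 5.
pose r := z - (2 * b + 2 * c + a) / 5.
have := sqr_ge0 p; have := sqr_ge0 q; have := sqr_ge0 r.
have := sqr_ge0 (p - q); have := sqr_ge0 (q - r); have := sqr_ge0 (p - r).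
rewrite /p /q /r => H1 H2 H3 H4 H5 H6.
by nra.
Qed.

Lemma renormalized_nondecreasing f :
  nondecreasing_seq (fun n => renormalized n f f).
Proof.
apply/nondecreasing_seqP => n; rewrite /renormalized exprSr -mulrA.
rewrite ler_pM2l ?exprn_gt0 ?divr_gt0//.
rewrite -[X in level_form X _ _ <= _](addn0 n) -[n.+1 in leRHS]addn1.
rewrite !level_form_cat mulr_sumr.
by apply: ler_sum => w _; exact: boundary_form_le.
Qed.

Lemma edge_le n f (w : seq 'I_3) i j : size w = n ->
  (f (act w (v i)) - f (act w (v j))) ^+ 2 <= level_form n f f.
Proof.
move=> /eqP sw; rewrite level_formE (bigD1 (Tuple sw)) //= (bigD1 i) //=.
rewrite (bigD1 j) //= -!addrA expr2 lerDl.
by rewrite !addr_ge0//; do ?[apply: sumr_ge0 => ? _]; exact: sqr_ge0.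
Qed.

Lemma act_cat w u x : act (w ++ u) x = act w (act u x).
Proof. by rewrite /act foldr_cat. Qed.

(* [4 / 5] is a rational upper bound for the ratio [sqrt (3 / 5)] between the
   oscillations along edges of consecutive levels. *)
Lemma chain_le n f (e : R) (u : seq 'I_3) : 0 <= e -> size u = n ->
  renormalized n f f <= e ^+ 2 ->
  `|f (act u (v ord0)) - f (v ord0)| <= 4 * e.
Proof.
move=> e_ge0 su fe.
suff H k : (k <= n)%N ->
    `|f (act (take k u) (v ord0)) - f (v ord0)| <= e * \sum_(i < k) (4/5) ^+ i.+1.
  have := H n (leqnn _); rewrite -{1}su take_size => /le_trans; apply.
  rewrite mulrC ler_wpM2r//.
  have -> : \sum_(i < n) (4 / 5) ^+ i.+1 = 4 - 4 * (4 / 5 : R) ^+ n.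
    elim: (n) => [|m IH]; first by rewrite big_ord0 expr0 mulr1 subrr.
    by rewrite big_ord_recr /= IH exprS; field.
  by rewrite lerBlDr lerDl mulr_ge0// exprn_ge0.
elim: k => [|k IH] kn.
  by rewrite take0 /= subrr normr0 big_ord0 mulr0.
rewrite big_ord_recr /= mulrDr.
rewrite -(subrKA (f (act (take k u) (v ord0)))) addrC.
rewrite (le_trans (ler_normD _ _))// lerD ?IH 1?ltnW//.
have ku : (k < size u)%N by rewrite su.
(* Both points are corners of the cell coded by [take k u] followed by [ord0]: the old one because
   [F ord0] fixes [v ord0], the new one by the junction identity. Each step of the chain is thus an
   edge of level k + 1, possibly degenerate. *)
rewrite (take_nth ord0)// -cats1 act_cat /= F_junction.
rewrite -[X in f (act _ X) - _]/(act [:: ord0] (v (nth ord0 u k))).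
rewrite -[in X in _ - X](F_fix ord0).
rewrite -[X in _ - f (act _ X)]/(act [:: ord0] (v ord0)) -!act_cat.
rewrite -ler_sqr ?nnegrE// ?mulr_ge0 ?exprn_ge0// real_normK ?num_real//.
have sk : size (take k u ++ [:: ord0]) = k.+1.
  by rewrite size_cat addn1 size_take ku.
apply: (le_trans (edge_le _ _ _ sk)).
have := le_trans (renormalized_nondecreasing f kn) fe.
rewrite /renormalized mulrC -ler_pdivlMr ?exprn_gt0 ?divr_gt0//.
move=> /le_trans; apply; rewrite [leRHS]exprMn ler_wpM2l ?sqr_ge0//.
rewrite -exprVn -[leRHS]exprM mulnC exprM; apply: lerXn2r;
  rewrite ?nnegrE ?invr_ge0//; lra.
Qed.

Definition limit_form f : R := limn (fun n => renormalized n f f).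

Definition finite_energy f :=
  exists M, forall n, renormalized n f f <= M.

Lemma renormalized_cvg f : finite_energy f ->
  (fun n => renormalized n f f) @ \oo --> limit_form f.
Proof.
move=> [M fM]; apply: nondecreasing_is_cvgn; first exact: renormalized_nondecreasing.
by exists M => _ [n _ <-].
Qed.

Lemma renormalized_le_limit f n : finite_energy f ->
  renormalized n f f <= limit_form f.
Proof.
move=> /renormalized_cvg /cvgP fE.
exact: (nondecreasing_cvgn_le (renormalized_nondecreasing f) fE).
Qed.

Lemma renormalized_cat m n f : renormalized (m + n) f f =
  (5 / 3) ^+ m * \sum_(w : m.-tuple 'I_3)
     renormalized n (fun x => f (act w x)) (fun x => f (act w x)).
Proof.
by rewrite /renormalized exprD -mulrA level_form_cat mulr_sumr.
Qed.

Lemma finite_energy_cell m (w : m.-tuple 'I_3) f : finite_energy f ->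
  finite_energy (fun x => f (act w x)).
Proof.
move=> [M fM]; exists (M / (5/3) ^+ m) => n.
rewrite ler_pdivlMr ?exprn_gt0 ?divr_gt0// mulrC.
apply: le_trans (fM (m + n)%N); rewrite renormalized_cat.
rewrite ler_pM2l ?exprn_gt0 ?divr_gt0// (bigD1 w)//= lerDl sumr_ge0// => u _.
by rewrite mulr_ge0 ?exprn_ge0 ?divr_ge0 ?level_form_ge0.
Qed.

(** The form of level m + n is the sum over the words of length m of forms of level n, so both sides
    are limits of one sequence; the factor makes up for the m renormalizations that the cells
    lack. *)
Lemma limit_form_cells m f : finite_energy f ->
  \sum_(w : m.-tuple 'I_3) limit_form (fun x => f (act w x)) =
  (3 / 5) ^+ m * limit_form f.
Proof.
move=> fE.
have c1 : (fun n => \sum_(w : m.-tuple 'I_3)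
     renormalized n (fun x => f (act w x)) (fun x => f (act w x))) @ \oo -->
    \sum_(w : m.-tuple 'I_3) limit_form (fun x => f (act w x)).
  apply: cvg_big => [|w _]; first exact: add_continuous.
  by apply: renormalized_cvg; exact: finite_energy_cell.
have c2 : (fun n => \sum_(w : m.-tuple 'I_3)
     renormalized n (fun x => f (act w x)) (fun x => f (act w x))) @ \oo -->
    (3 / 5) ^+ m * limit_form f.
  have -> : (fun n => \sum_(w : m.-tuple 'I_3)
     renormalized n (fun x => f (act w x)) (fun x => f (act w x))) =
     (fun n => (3 / 5) ^+ m * renormalized (n + m) f f).
    apply/funext => n; rewrite addnC renormalized_cat mulrA -exprMn.
    by rewrite (_ : 3 / 5 * (5 / 3) = 1 :> R) ?expr1n ?mul1r//; field.
  apply: cvgM; first exact: cvg_cst.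
  by rewrite (cvg_shiftn m (fun n => renormalized n f f)); exact: renormalized_cvg.
exact: (cvg_unique _ c1 c2).
Qed.

Lemma limit_form_ge0 f : finite_energy f -> 0 <= limit_form f.
Proof.
move=> fE; apply: le_trans (renormalized_le_limit 0 fE).
by rewrite mulr_ge0 ?exprn_ge0 ?divr_ge0 ?level_form_ge0.
Qed.

Lemma sqr_chain_le f (u : seq 'I_3) : finite_energy f ->
  (f (act u (v ord0)) - f (v ord0)) ^+ 2 <= 16 * limit_form f.
Proof.
move=> fE; have f0 := limit_form_ge0 fE.
have := @chain_le _ f (Num.sqrt (limit_form f)) u (sqrtr_ge0 _) erefl.
rewrite sqr_sqrtr// => /(_ (renormalized_le_limit _ fE)).
rewrite -ler_sqr ?nnegrE ?mulr_ge0 ?sqrtr_ge0// real_normK ?num_real//.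
by rewrite exprMn sqr_sqrtr// -natrX.
Qed.

End selfsimilar_energy.

(** * Real-valued modulus on the complex plane *)

Section plane_modulus.
Local Open Scope complex_scope.
Context {R : realType}.
Implicit Types x y z : plane R.

(** The norm of [R[i]] takes its values in [R[i]]; its real part allows estimates in [R]. *)
Definition modulus z : R := complex.Re `|z|.

Lemma normE z : `|z| = (modulus z)%:C.
Proof. by rewrite /modulus normc_def. Qed.

Lemma modulusB x y : modulus (x - y) = modulus (y - x).
Proof. by rewrite /modulus distrC. Qed.

Lemma ler_modulusD x y : modulus (x + y) <= modulus x + modulus y.
Proof. by rewrite -lecR rmorphD /= -!normE ler_normD. Qed.

Lemma modulus_half z : modulus (z / 2) = modulus z / 2.
Proof.
apply: (@complexI R); rewrite -normE normrM normE [RHS]rmorphM; congr (_ * _).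
by rewrite fmorphV rmorph_nat normfV normr_nat.
Qed.

Lemma modulus_cvg (M : R) (u : nat -> plane R) z :
  (forall n, modulus (u n - z) <= M * 2^-1 ^+ n) -> u @ \oo --> z.
Proof.
move=> uz; apply/cvgrPdist_lt => e e0.
have eE : e = (complex.Re e)%:C by rewrite RRe_real// gtr0_real.
have {}e0 : 0 < complex.Re e by rewrite -ltcR -eE.
have : M * 2^-1 ^+ n @[n --> \oo] --> (0 : R).
  by apply: cvg_geometric; rewrite gtr0_norm ?invf_lt1 ?ltr1n ?invr_gt0.
move=> /cvgrPdist_lt/(_ _ e0); apply: filterS => n.
rewrite sub0r normrN eE normE ltcR modulusB => /(le_lt_trans (ler_norm _)).
exact: le_lt_trans.
Qed.

Lemma modulusB_continuous z : continuous (fun x => modulus (x - z)).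
Proof.
move=> x; apply/(@cvgrPdist_lt _ _ _ _ (nbhs_filter x)) => e e0.
exists e%:C => [|y]; first by rewrite /= ltcR.
rewrite /ball_/= normE ltcR; apply: le_lt_trans.
rewrite ler_norml; have := ler_modulusD (x - y) (y - z); rewrite subrKA => h1.
have := ler_modulusD (y - x) (x - z); rewrite subrKA (modulusB y x) => h2.
by apply/andP; split; lra.
Qed.

End plane_modulus.

(** * The maps of the gasket *)

Section contractions.
Local Open Scope complex_scope.
Context {R : realType} (p : 'I_3 -> plane R).

Lemma contractionB i y z :
  contraction p i y - contraction p i z = (y - z) / 2.
Proof. by rewrite /contraction opprD addrACA subrr addr0 -mulrBl opprB addrA subrK. Qed.

Lemma contraction_fix i : contraction p i (p i) = p i.
Proof. by rewrite /contraction subrr mul0r add0r. Qed.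

Lemma contraction_junction i j : contraction p i (p j) = contraction p j (p i).
Proof. rewrite /contraction; by field. Qed.

Lemma contraction_continuous i : continuous (contraction p i).
Proof.
move=> z; apply/(@cvgrPdist_lt _ _ _ _ (nbhs_filter z)) => e e0.
exists e => // y; rewrite /ball_/= contractionB; apply: le_lt_trans.
by rewrite normrM normfV normr_nat ler_piMr// invf_le1 ?ler1n ?ltr0n.
Qed.

Lemma foldr_contraction_continuous (w : seq 'I_3) :
  continuous (fun z => foldr (contraction p) z w).
Proof.
elim: w => [|i w IH] x /=; first exact: cvg_id.
apply: (@continuous_comp _ _ _ (fun z => foldr (contraction p) z w)
  (contraction p i)); first exact: IH.
exact: contraction_continuous.
Qed.

Lemma foldr_contractionB (w : seq 'I_3) y z :
  foldr (contraction p) y w - foldr (contraction p) z w = (y - z) / 2 ^+ size w.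
Proof.
elim: w => [|i w IH] /=; first by rewrite expr0 divr1.
by rewrite contractionB IH exprSr invfM mulrA.
Qed.

Lemma modulus_foldr_contractionB (w : seq 'I_3) y z :
  modulus (foldr (contraction p) y w - foldr (contraction p) z w) =
  modulus (y - z) * 2^-1 ^+ size w.
Proof.
elim: w => [|i w IH] /=; first by rewrite expr0 mulr1.
by rewrite contractionB modulus_half IH exprSr mulrA.
Qed.

End contractions.

Section gasket_maps.
Local Open Scope complex_scope.
Context {R : realType} (G : gasket R).

Lemma carrier_closed : closed (carrier G).
Proof. by apply: compact_closed (@carrier_compact _ G); exact: norm_hausdorff. Qed.

Lemma contraction_carrier i z :
  carrier G z -> carrier G (contraction (vertex G) i z).
Proof. by move=> Gz; rewrite carrier_selfsimilar; exists i => //; exists z. Qed.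

(** Iterating the i-th contraction from any point of the carrier gives points of the carrier that
    converge to the fixed point, and the carrier is closed. *)
Lemma vertex_carrier i : carrier G (vertex G i).
Proof.
have [x Gx] := carrier_nonempty G.
pose u n := foldr (contraction (vertex G)) x (nseq n i).
have Gu n : carrier G (u n).
  by elim: n => [|n IH]//; rewrite /u /=; exact: contraction_carrier.
have ui : u n @[n --> \oo] --> vertex G i.
  apply: (@modulus_cvg _ (modulus (x - vertex G i))) => n.
  rewrite -{2}(size_nseq n i) -(modulus_foldr_contractionB (vertex G)).
  rewrite (_ : foldr _ (vertex G i) _ = vertex G i)//.
  by elim: (n) => //= m ->; rewrite contraction_fix.
have nG : \forall n \near \oo, carrier G (u n) by exact: nearW.
exact: (@closed_cvg _ _ _ _ u (carrier G) carrier_closed nG _ ui).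
Qed.

Definition gasket_map (i : 'I_3) (x : K G) : K G :=
  exist _ (contraction (vertex G) i (val x))
    (mem_set (contraction_carrier i (set_mem (valP x)))).

Definition gasket_vertex (i : 'I_3) : K G :=
  exist _ (vertex G i) (mem_set (vertex_carrier i)).

Lemma gasket_map_fix i : gasket_map i (gasket_vertex i) = gasket_vertex i.
Proof. by apply: val_inj; rewrite /= contraction_fix. Qed.

Lemma gasket_map_junction i j :
  gasket_map i (gasket_vertex j) = gasket_map j (gasket_vertex i).
Proof. by apply: val_inj; rewrite /= contraction_junction. Qed.

Lemma val_act w x :
  val (act gasket_map w x) = foldr (contraction (vertex G)) (val x) w.
Proof. by elim: w => //= i w ->. Qed.

Lemma gasket_map_surj x : exists i y, x = gasket_map i y.
Proof.
have := set_mem (valP x); rewrite {1}carrier_selfsimilar => -[i _ [z Gz zx]].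
by exists i, (exist _ z (mem_set Gz)); apply: val_inj.
Qed.

Lemma act_surj n x : exists (w : n.-tuple 'I_3) y, x = act gasket_map w y.
Proof.
elim: n x => [|n IH] x; first by exists [tuple], x.
have [i [y ->]] := gasket_map_surj x; have [w [z ->]] := IH y.
by exists (cons_tuple i w), z.
Qed.

Lemma val_continuous : continuous (val : K G -> plane R).
Proof. exact: initial_continuous. Qed.

Lemma val_cvg (u : nat -> K G) (x : K G) :
  val (u n) @[n --> \oo] --> (val x : plane R) -> u @ \oo --> x.
Proof.
move=> ux U [B [[W oW <-] Wx] sub].
have /ux : nbhs (val x : plane R) W by exact: open_nbhs_nbhs.
apply: (@filterS _ \oo _ (fun n => W (val (u n)))) => n Wn; exact: sub.
Qed.

Lemma act_continuous w : continuous (act gasket_map w).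
Proof.
move=> x U [B [[W oW <-] Wx] sub].
pose h : K G -> plane R := fun y => foldr (contraction (vertex G)) (val y) w.
have ch : {for x, continuous h} := continuous_comp (@val_continuous x)
  (foldr_contraction_continuous (p := vertex G) (w := w) (x := val x)).
have /ch Wh : nbhs (h x) W.
  by apply: open_nbhs_nbhs; split=> //; move: Wx; rewrite /= set_valE val_act.
apply: (@filterS _ (nbhs x) _ (h @^-1` W)) => // y Wy; apply: sub.
by rewrite /= set_valE val_act.
Qed.

Lemma carrier_bounded (z : plane R) : exists M, forall x : K G, modulus (val x - z) <= M.
Proof.
have c : {within carrier G, continuous (fun x => modulus (x - z))}.
  by apply: continuous_subspaceT; exact: modulusB_continuous.
have /compact_bounded[M [_ HM]] := continuous_compact c (@carrier_compact _ G).
exists (M + 1) => x; apply: le_trans (ler_norm _) _.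
by apply: (HM (M + 1)); [rewrite ltrDl|exists (val x) => //; exact: set_mem (valP x)].
Qed.

Lemma cell_act n (w : n.-tuple 'I_3) : cell w = range (act gasket_map w).
Proof.
apply/seteqP; split => x.
  move=> [z Gz zx]; exists (exist _ z (mem_set Gz)) => //.
  by apply: val_inj; rewrite val_act /= -zx.
by move=> [y _ <-]; exists (val y); rewrite ?val_act//; exact: set_mem (valP y).
Qed.

Lemma cell_closed n (w : n.-tuple 'I_3) : closed (cell w : set (K G)).
Proof.
move/continuous_closedP: (@val_continuous); apply; rewrite -/(closed _).
apply: compact_closed; first exact: norm_hausdorff.
apply: continuous_compact; last exact: carrier_compact.
apply: continuous_subspaceT; exact: foldr_contraction_continuous.
Qed.

Lemma measurable_cell n (w : n.-tuple 'I_3) : measurable (cell w : set (K G)).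
Proof.
rewrite -[X in measurable X]setCK; apply: measurableC; apply: sub_sigma_algebra.
by rewrite openC; exact: cell_closed.
Qed.

Lemma continuous_measurable (f : K G -> R) : continuous f -> measurable_fun setT f.
Proof.
move=> cf; apply: (measurability _ (measurable_realfun.RGenOpens.measurableE R)).
move=> _ [_ [a [b ->] <-]]; rewrite setTI; apply: sub_sigma_algebra.
by move/continuousP: cf; apply; exact: interval_open.
Qed.

(** The n-th word codes a cell of level n containing x, and such a cell has diameter O(2^-n). The
    words are chosen separately for each n and need not extend one another: the chaining bound holds
    for every word. *)
Lemma vertex_approximation (x : K G) : exists u : nat -> seq 'I_3,
  act gasket_map (u n) (gasket_vertex ord0) @[n --> \oo] --> x.
Proof.
have /choice[u uP] : forall n, exists w : seq 'I_3,
    size w = n /\ exists y, x = act gasket_map w y.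
  move=> n; have [w [y ->]] := act_surj n x.
  by exists w; rewrite size_tuple; split => //; exists y.
exists u; have [M HM] := carrier_bounded (vertex G ord0).
apply: val_cvg; apply: (@modulus_cvg _ M) => n.
have [su [y ->]] := uP n.
rewrite !val_act modulus_foldr_contractionB su ler_wpM2r// ?exprn_ge0//.
by rewrite modulusB HM.
Qed.

Lemma sqr_oscillation_le (f : K G -> R) x : continuous f ->
  finite_energy gasket_map gasket_vertex f ->
  (f x - f (gasket_vertex ord0)) ^+ 2 <= 16 * limit_form gasket_map gasket_vertex f.
Proof.
move=> cf fE; have [u ux] := vertex_approximation x.
have fu : f (act gasket_map (u n) (gasket_vertex ord0)) @[n --> \oo] --> f x.
  exact: (cvg_comp _ _ ux (cf x)).
have : (f (act gasket_map (u n) (gasket_vertex ord0)) - f (gasket_vertex ord0)) ^+ 2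
   @[n --> \oo] --> (f x - f (gasket_vertex ord0)) ^+ 2.
  by rewrite expr2; apply: cvgM; apply: cvgB => //; exact: cvg_cst.
move=> /cvgr_to_le; apply; apply: nearW => n.
by apply: sqr_chain_le => //; [exact: gasket_map_fix|exact: gasket_map_junction].
Qed.

End gasket_maps.

(** * Barycentric coordinates and the coding of cells by words *)

Lemma ord3P (i : 'I_3) :
  [\/ i = ord0, i = lift ord0 ord0 | i = lift ord0 (lift ord0 ord0)].
Proof.
by case: i => [[|[|[|//]]]] ?; [apply: Or31|apply: Or32|apply: Or33]; exact: val_inj.
Qed.

Section barycentric.
Local Open Scope complex_scope.
Context {R : realType} (p : 'I_3 -> plane R).
Hypothesis p_dist : forall i j, i != j -> `|p i - p j| = 1.

(** With c the centroid, the double sum is 9 <z - c, p_i - c>, so this is 1/3 + 2 <z - c, p_i - c>: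
    for a triangle of side 1, where |p_i - c|^2 = 1/3, the affine function equal to 1 at p_i and to
    0 at the other two vertices. *)
Definition barycentric (i : 'I_3) (z : plane R) : R :=
  1 / 3 + 2 / 9 * \sum_j \sum_k
    ((complex.Re z - complex.Re (p k)) * (complex.Re (p i) - complex.Re (p j)) +
     (complex.Im z - complex.Im (p k)) * (complex.Im (p i) - complex.Im (p j))).

Lemma barycentricB i (y z y' z' : plane R) : y - z = y' - z' ->
  barycentric i y - barycentric i z = barycentric i y' - barycentric i z'.
Proof.
rewrite /barycentric !big_ord_recl !big_ord0.
case: y z y' z' => [y1 y2] [z1 z2] [y1' y2'] [z1' z2'] [e1 e2] /=.
have -> : y1 = y1' - z1' + z1 by lra.
have -> : y2 = y2' - z2' + z2 by lra.
by ring.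
Qed.

Lemma barycentric_mid i (c y z : plane R) : c + c = y + z ->
  barycentric i c = (barycentric i y + barycentric i z) / 2.
Proof.
move=> e; have : c - y = z - c.
  by apply/eqP; rewrite subr_eq addrAC [z + y]addrC -e addrK.
by move=> /(barycentricB i); lra.
Qed.

Lemma barycentric_vertex i j : barycentric i (p j) = (i == j)%:R.
Proof.
have D (k l : 'I_3) : k != l -> (complex.Re (p k) - complex.Re (p l)) ^+ 2 +
    (complex.Im (p k) - complex.Im (p l)) ^+ 2 = 1.
  move=> /p_dist; case: (p k) (p l) => [a b] [c d] /(congr1 (fun z => z ^+ 2)).
  by rewrite -add_Re2_Im2 expr1n /= => -[].
have := D ord0 (lift ord0 ord0) isT.
have := D ord0 (lift ord0 (lift ord0 ord0)) isT.
have := D (lift ord0 ord0) (lift ord0 (lift ord0 ord0)) isT.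
rewrite /barycentric !big_ord_recl !big_ord0.
by case: (ord3P i) => ->; case: (ord3P j) => -> /=; nra.
Qed.

Lemma barycentric_contraction i j z :
  barycentric i (contraction p j z) = (barycentric i z + (i == j)%:R) / 2.
Proof.
rewrite -barycentric_vertex; apply: barycentric_mid.
by rewrite /contraction; field.
Qed.

(** The i-th coordinate increases by 1 from p_j to p_i, which forces k = i; the j-th one decreases
    by 1, which forces l = j. *)
Lemma vertexB_inj i j k l : i != j -> p i - p j = p k - p l -> i = k /\ j = l.
Proof.
move=> ij e.
have := barycentricB i e; have := barycentricB j e; rewrite !barycentric_vertex !eqxx => {e}.
rewrite (negbTE ij) eq_sym (negbTE ij).
case: (eqVneq i k) => [->|_]; case: (eqVneq j l) => [->|_] //=.
- by case: (j == k) => /= ? ?; exfalso; lra.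
- by case: (i == l) => /= ? ?; exfalso; lra.
- by case: (i == l) => /= ? ?; exfalso; lra.
Qed.

(* An interior point of the triangle: its image under the i-th contraction is
   the only one of the three with i-th barycentric coordinate above 1/2. *)
Definition interior_point : plane R :=
  contraction p ord0 (contraction p (lift ord0 ord0) (p (lift ord0 (lift ord0 ord0)))).

Lemma barycentric_interior (w : seq 'I_3) i :
  0 < barycentric i (foldr (contraction p) interior_point w) < 1.
Proof.
elim: w => [|j w /andP[h0 h1]] /=.
  rewrite !barycentric_contraction barycentric_vertex.
  by case: (ord3P i) => -> /=; lra.
by rewrite barycentric_contraction; case: (i == j) => /=; lra.
Qed.

(** A junction point lies in several cells, so the letters cannot be read off the image of y. But
    two words of the same length act with the same linear part, hence maps that agree at y agree at
    [interior_point], whose images reveal the letters one by one. *)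
Lemma foldr_contraction_inj n (w u : n.-tuple 'I_3) y :
  foldr (contraction p) y w = foldr (contraction p) y u -> w = u.
Proof.
have E (t : n.-tuple 'I_3) : foldr (contraction p) interior_point t -
    foldr (contraction p) y t = (interior_point - y) / 2 ^+ n.
  by rewrite foldr_contractionB size_tuple.
move=> e0; have := E w; rewrite e0 -(E u) => /addIr {E e0}.
move=> e; apply: val_inj => /=.
have : size w = size u by rewrite !size_tuple.
elim: (tval w) (tval u) e => {w u} [|i w IH] [|j u] //= e [su].
have eij : i = j.
  apply/eqP; apply: contraT => ij; clear su.
  have := barycentric_contraction i i (foldr (contraction p) interior_point w).
  rewrite e barycentric_contraction eqxx (negbTE ij) /= addr0 => {}e.
  have := barycentric_interior w i; have := barycentric_interior u i.
  by move=> /andP[? ?] /andP[? ?]; lra.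
rewrite -eij in e *; congr cons; apply: IH => //.
have /eqP := contractionB p i (foldr (contraction p) interior_point w)
   (foldr (contraction p) interior_point u).
by rewrite e subrr eq_sym mulf_eq0 invr_eq0 pnatr_eq0 orbF subr_eq0 => /eqP.
Qed.

End barycentric.

(** * Arcs of the graphs indexed by words *)

Section energy_words.
Local Open Scope complex_scope.
Context {R : realType} (G : gasket R).
Local Notation act := (act (@gasket_map _ G)).
Local Notation v := (@gasket_vertex _ G).

Lemma vertices_act m (w : m.-tuple 'I_3) i : vertices G m (val (act w (v i))).
Proof.
elim: m w => [|m IH] w; first by rewrite tuple0; exists i.
rewrite [w]tuple_eta; exists (thead w) => //.
by exists (val (act (behead_tuple w) (v i))).
Qed.

Lemma word_vertices m (w : m.-tuple 'I_3) (x : plane R) :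
  (word_map G w @` vertices G 0) x <-> exists i, x = val (act w (v i)).
Proof.
split.
  by move=> [_ [i _ <-] <-]; exists i; rewrite val_act.
by move=> [i ->]; exists (vertex G i); [exists i|rewrite val_act].
Qed.

(** The difference of the endpoints is 2^-m times an edge vector of the triangle, which reveals the
    ordered pair of corners; one common corner then reveals the word. *)
Lemma act_vertices_inj m (w u : m.-tuple 'I_3) i j k l : i != j ->
  act w (v i) = act u (v k) -> act w (v j) = act u (v l) -> [/\ w = u, i = k & j = l].
Proof.
move=> ij /(congr1 val) e1 /(congr1 val) e2; rewrite !val_act /= in e1 e2.
have [ik jl] : i = k /\ j = l.
  apply: (vertexB_inj (@vertex_dist _ G) ij).
  have := foldr_contractionB (vertex G) w (vertex G i) (vertex G j).
  rewrite e1 e2 foldr_contractionB !size_tuple.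
  by move=> /(mulIf (invr_neq0 (expf_neq0 _ (@lt0r_neq0 R[i] 2 (ltr0n _ 2))))) /esym.
split=> //; apply: (@foldr_contraction_inj _ (vertex G) (@vertex_dist _ G) m w u (vertex G i)).
by rewrite e1 ik.
Qed.

(** Arcs correspond bijectively to a word with an ordered pair of distinct corners. The constant is
    5^m / (3^(m+1) / 2) * (1/2) = (5/3)^m / 3. *)
Lemma energy_atE m (f : K G -> R) :
  energy_at m f = renormalized (@gasket_map _ G) (@gasket_vertex _ G) m f f / 3.
Proof.
rewrite /energy_at /renormalized level_formE.
pose P := [pred t : m.-tuple 'I_3 * ('I_3 * 'I_3) | t.2.1 != t.2.2].
pose h (t : m.-tuple 'I_3 * ('I_3 * 'I_3)) := (act t.1 (v t.2.1), act t.1 (v t.2.2)).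
rewrite (@reindex_fsbig _ _ _ _ _ h [set` P]); last first.
  split.
  - move=> [w [i j]] /= ij; split; [exact: vertices_act|exact: vertices_act|].
    split; last by exists w; split; apply/word_vertices; eexists.
    apply/eqP => /val_inj e.
    have [_ ii _] := act_vertices_inj ij e (esym e).
    by move/eqP: ij; exact.
  - move=> [w [i j]] [u [k l]]; rewrite !inE /= => ij _ [e1 e2].
    by have /= [-> -> ->] := act_vertices_inj ij e1 e2.
  - move=> [x y] [_ _ [xy [w [/word_vertices[i /val_inj ex] /word_vertices[j /val_inj ey]]]]].
    rewrite /= in ex ey xy.
    exists (w, (i, j)); last by rewrite /h /= -ex -ey.
    by rewrite /=; apply: contraNneq xy => /= ij; rewrite ex ey ij.
rewrite -(bigfs _ (index_enum_uniq _)); last by move=> t _; rewrite mem_index_enum.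
have -> : \sum_(w : m.-tuple 'I_3) \sum_i \sum_j
     (f (act w (v i)) - f (act w (v j))) * (f (act w (v i)) - f (act w (v j))) =
  \sum_(t | P t) (f (h t).1 - f (h t).2) ^+ 2.
  rewrite (eq_bigr (fun w => \sum_(ij : 'I_3 * 'I_3)
      (f (act (val w) (v ij.1)) - f (act (val w) (v ij.2))) *
      (f (act (val w) (v ij.1)) - f (act (val w) (v ij.2))))); last first.
    by move=> w _; rewrite pair_bigA.
  rewrite pair_bigA /= [RHS]big_mkcond; apply: eq_bigr => -[w [i j]] _ /=.
  by case: eqP => //= ->; rewrite subrr mul0r.
by rewrite exprMn exprVn [3 ^+ m.+1]exprS; field; rewrite expf_neq0.
Qed.

End energy_words.

(** * The Dirichlet form as a limit of discrete energies *)

Section energy_limit.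
Context {R : realType} (G : gasket R).
Implicit Types f g : K G -> R.
Local Notation renorm := (renormalized (@gasket_map _ G) (@gasket_vertex _ G)).
Local Notation finite_energy := (finite_energy (@gasket_map _ G) (@gasket_vertex _ G)).
Local Notation limit_energy := (limit_form (@gasket_map _ G) (@gasket_vertex _ G)).

Let fixP := @gasket_map_fix _ G.
Let junctionP := @gasket_map_junction _ G.

Lemma finite_energyP f : (energy f < +oo)%E -> finite_energy f.
Proof.
move=> fE; have nd : nondecreasing_seq (fun m => (energy_at m f)%:E).
  move=> m n mn; rewrite lee_fin !energy_atE ler_pM2r ?invr_gt0 ?ltr0n//.
  exact: renormalized_nondecreasing fixP junctionP _ _ _ mn.
have le m : ((energy_at m f)%:E <= energy f)%E.
  rewrite /energy (cvg_lim _ (ereal_nondecreasing_cvgn nd))//.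
  by apply: ereal_sup_ubound; exists m.
exists (3 * fine (energy f)) => n; rewrite mulrC -ler_pdivrMr ?ltr0n// -energy_atE.
rewrite -lee_fin fineK// fin_numE -ltey fE andbT.
by rewrite -ltNye; apply: lt_le_trans (le 0%N); rewrite ltNyr.
Qed.

Lemma energyE f : finite_energy f -> energy f = (limit_energy f / 3)%:E.
Proof.
move=> /(renormalized_cvg fixP junctionP) fE; apply: cvg_lim => //.
apply: cvg_EFin; first exact: nearW.
have -> : fine \o (fun m => (energy_at m f)%:E) = fun m => renorm m f f / 3.
  by apply/funext => m; rewrite /= energy_atE.
by apply: cvgM => //; exact: cvg_cst.
Qed.

Lemma finite_energyDB f g : finite_energy f -> finite_energy g ->
  finite_energy (fun x => f x + g x) /\ finite_energy (fun x => f x - g x).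
Proof.
move=> [M fM] [N gN].
have e n : renorm n (fun x => f x + g x) (fun x => f x + g x) +
           renorm n (fun x => f x - g x) (fun x => f x - g x) <= 2 * (M + N).
  rewrite -mulrDr level_form_parallelogram mulrCA ler_pM2l ?ltr0n//.
  by rewrite mulrDr; exact: (lerD (fM n) (gN n)).
have ge0 n h : 0 <= renorm n h h.
  by rewrite mulr_ge0 ?exprn_ge0 ?divr_ge0 ?level_form_ge0.
split; exists (2 * (M + N)) => n; apply: le_trans (e n).
  by rewrite lerDl; exact: ge0.
by rewrite lerDr; exact: ge0.
Qed.

(** [form] is a polarization of limits; as a limit of bilinear discrete forms it can be evaluated on
    linear combinations. *)
Lemma renormalized_form_cvg f g : finite_energy f -> finite_energy g ->
  renorm n f g @[n --> \oo] --> 3 * form f g.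
Proof.
move=> fE gE; have [aE bE] := finite_energyDB fE gE.
rewrite /form !energyE//= -mulrBl.
have -> : (fun n => renorm n f g) = (fun n => 3 *
  ((renorm n (fun x => f x + g x) (fun x => f x + g x) -
    renorm n (fun x => f x - g x) (fun x => f x - g x)) / 3 / 4)).
  apply/funext => n; rewrite -mulrBr level_form_polarization /renormalized.
  by field.
apply: cvgM; first exact: cvg_cst.
apply: cvgM; last exact: cvg_cst.
apply: cvgM; last exact: cvg_cst.
by apply: cvgB; exact: (renormalized_cvg fixP junctionP).
Qed.

End energy_limit.

(** * The inner product of L^2 *)

Section square_integrable.
Context {R : realType} (G : gasket R) (mu : {measure set (K G) -> \bar R}).
Implicit Types f g h : K G -> R.

Lemma L2_comb c f g : f \in Lfun mu 2%:E -> g \in Lfun mu 2%:E ->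
  (fun x => c * f x + g x) \in Lfun mu 2%:E.
Proof.
move=> f2 g2; have p1 : (1 <= 2%:E :> \bar R)%E by rewrite lee_fin ler1n.
by have [_ /(_ c f g f2 g2)] := Lfun_submod_closed mu p1.
Qed.

Lemma L2_0 : (fun=> 0) \in Lfun mu 2%:E.
Proof.
have p1 : (1 <= 2%:E :> \bar R)%E by rewrite lee_fin ler1n.
by have [] := Lfun_submod_closed mu p1.
Qed.

Lemma L2_scale c f : f \in Lfun mu 2%:E -> (fun x => c * f x) \in Lfun mu 2%:E.
Proof.
move=> f2; rewrite (_ : (fun x => _) = fun x => c * f x + 0).
  exact: L2_comb f2 L2_0.
by apply/funext => x; rewrite addr0.
Qed.

Lemma L2B f g : f \in Lfun mu 2%:E -> g \in Lfun mu 2%:E ->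
  (fun x => f x - g x) \in Lfun mu 2%:E.
Proof.
move=> f2 g2; rewrite (_ : (fun x => _) = fun x => - 1 * g x + f x).
  exact: L2_comb g2 f2.
by apply/funext => x; rewrite mulN1r addrC.
Qed.

Lemma L2_sum n (c : 'I_n -> R) (f_ : 'I_n -> K G -> R) :
  (forall j, f_ j \in Lfun mu 2%:E) ->
  (fun x => \sum_(j < n) c j * f_ j x) \in Lfun mu 2%:E.
Proof.
elim: n c f_ => [|n IH] c f_ f2.
  rewrite (_ : (fun x => _) = fun=> 0); first exact: L2_0.
  by apply/funext => x; rewrite big_ord0.
rewrite (_ : (fun x => _) = fun x => c ord0 * f_ ord0 x +
    \sum_(j < n) c (lift ord0 j) * f_ (lift ord0 j) x).
  exact: L2_comb (f2 ord0) (IH _ _ (fun j => f2 (lift ord0 j))).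
by apply/funext => x; rewrite big_ord_recl.
Qed.

Lemma ipC f g : ip mu f g = ip mu g f.
Proof. by apply: eq_Rintegral => x _; rewrite mulrC. Qed.

Lemma L2_integrable f g : f \in Lfun mu 2%:E -> g \in Lfun mu 2%:E ->
  mu.-integrable setT (EFin \o (fun x => f x * g x)).
Proof. by move=> f2 g2; apply/Lfun1_integrable; exact: Lfun2_mul_Lfun1. Qed.

Lemma ip_comb c f g h : f \in Lfun mu 2%:E -> g \in Lfun mu 2%:E ->
  h \in Lfun mu 2%:E ->
  ip mu (fun x => c * f x + g x) h = c * ip mu f h + ip mu g h.
Proof.
move=> f2 g2 h2; rewrite /ip -RintegralZl//; last exact: L2_integrable.
rewrite -RintegralD//; last 2 first.
- rewrite (_ : EFin \o _ = EFin \o (fun x => c * f x * h x)).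
    exact: L2_integrable (L2_scale c f2) h2.
  by apply/funext => x /=; rewrite mulrA.
- exact: L2_integrable.
by apply: eq_Rintegral => x _; rewrite mulrDl mulrA.
Qed.

Lemma ip0l h : ip mu (fun=> 0) h = 0.
Proof.
rewrite /ip (_ : (fun x => 0 * h x) = cst 0).
  by rewrite /Rintegral integral0.
by apply/funext => x; rewrite mul0r.
Qed.

Lemma ip_scale c f h : f \in Lfun mu 2%:E -> h \in Lfun mu 2%:E ->
  ip mu (fun x => c * f x) h = c * ip mu f h.
Proof.
move=> f2 h2; have := ip_comb c f2 L2_0 h2; rewrite ip0l addr0 => <-.
by congr ip; apply/funext => x; rewrite addr0.
Qed.

Lemma ipBl f g h : f \in Lfun mu 2%:E -> g \in Lfun mu 2%:E ->
  h \in Lfun mu 2%:E -> ip mu (fun x => f x - g x) h = ip mu f h - ip mu g h.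
Proof.
move=> f2 g2 h2; have := ip_comb (- 1) g2 f2 h2; rewrite mulN1r addrC => <-.
by congr ip; apply/funext => x; rewrite mulN1r addrC.
Qed.

Lemma ip_suml n (c : 'I_n -> R) (f_ : 'I_n -> K G -> R) h :
  (forall j, f_ j \in Lfun mu 2%:E) -> h \in Lfun mu 2%:E ->
  ip mu (fun x => \sum_(j < n) c j * f_ j x) h = \sum_(j < n) c j * ip mu (f_ j) h.
Proof.
move=> f2 h2; elim: n c f_ f2 => [|n IH] c f_ f2.
  rewrite big_ord0 -[RHS](ip0l h); congr ip.
  by apply/funext => x; rewrite big_ord0.
rewrite big_ord_recl -IH// -ip_comb//; last exact: L2_sum.
by congr ip; apply/funext => x; rewrite big_ord_recl.
Qed.

End square_integrable.

(** * Lower bound for the eigenvalues *)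

Lemma continuous_comb (R : realType) (T : topologicalType) n (c : 'I_n -> R)
    (f_ : 'I_n -> T -> R) :
  (forall j, continuous (f_ j)) -> continuous (fun x => \sum_(j < n) c j * f_ j x).
Proof.
move=> cf x; apply: cvg_big => [|j _]; first exact: add_continuous.
by apply: cvgM; [exact: cvg_cst|exact: cf].
Qed.

Section eigenvalue_lower_bound.
Context {R : realType} (G : gasket R) (mu : {measure set (K G) -> \bar R}).
Hypothesis hmu : selfsimilar_measure mu.
Local Notation act := (act (@gasket_map _ G)).
Local Notation v := (@gasket_vertex _ G).
Local Notation renorm := (renormalized (@gasket_map _ G) (@gasket_vertex _ G)).
Local Notation finite_energy := (finite_energy (@gasket_map _ G) (@gasket_vertex _ G)).
Local Notation limit_energy := (limit_form (@gasket_map _ G) (@gasket_vertex _ G)).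

Let fixP := @gasket_map_fix _ G.
Let junctionP := @gasket_map_junction _ G.

Lemma selfsimilar_setT : mu setT = 1%E.
Proof.
have := hmu [tuple]; rewrite expr0 invr1 => <-; congr (mu _).
by rewrite cell_act; apply/seteqP; split => // x _; exists x.
Qed.

Lemma Poincare m (f : K G -> R) : continuous f -> finite_energy f ->
  (forall w : m.-tuple 'I_3, f (act w (v ord0)) = 0) ->
  ip mu f f <= 16 * 5^-1 ^+ m * limit_energy f.
Proof.
move=> cf fE f0.
pose c (w : m.-tuple 'I_3) := 16 * limit_energy (fun x => f (act w x)).
have c_ge0 w : 0 <= c w.
  rewrite mulr_ge0 ?ler0n//; apply: limit_form_ge0 => //.
  by apply: finite_energy_cell.
have mc w : measurable (cell w : set (K G)) by exact: measurable_cell.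
(* Cells overlap at junction points, but only an upper bound is wanted: one cell containing x
   suffices, and the other terms are nonnegative. *)
have le x : f x * f x <= \sum_(w : m.-tuple 'I_3) c w * \1_(cell w : set (K G)) x.
  have [w [y xy]] := act_surj m x.
  rewrite (bigD1 w)//= indicE mem_set ?mulr1; last first.
    by rewrite cell_act; exists y.
  rewrite -[leLHS]addr0 lerD//; last first.
    by apply: sumr_ge0 => u _; rewrite mulr_ge0// indicE ler0n.
  have := @sqr_oscillation_le _ _ (fun x => f (act w x)) y.
  rewrite f0 subr0 expr2 -xy; apply.
    by move=> z; apply: (continuous_comp (@act_continuous _ _ w z) (cf _)).
  by apply: finite_energy_cell.
have int_le : (\int[mu]_x (f x * f x)%:E <=
    \int[mu]_x (\sum_(w : m.-tuple 'I_3) (c w * \1_(cell w : set (K G)) x)%:E))%E.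
  apply: ge0_le_integral => //.
  - by move=> x _; rewrite lee_fin -expr2 sqr_ge0.
  - apply/measurable_EFinP; apply: measurable_funM; exact: continuous_measurable.
  - apply: emeasurable_sum => w; apply/measurable_EFinP.
    by apply: measurable_funM => //; exact: measurable_indic.
  - by move=> x _; rewrite sumEFin lee_fin.
have int_eq : (\int[mu]_x (\sum_(w : m.-tuple 'I_3) (c w * \1_(cell w : set (K G)) x)%:E))%E
    = (16 * 5^-1 ^+ m * limit_energy f)%:E.
  rewrite ge0_integral_sum//; last 2 first.
  - by move=> w; apply/measurable_EFinP; apply: measurable_funM => //; exact: measurable_indic.
  - by move=> w x _; rewrite lee_fin mulr_ge0// indicE ler0n.
  rewrite (eq_bigr (fun w => (c w * 3 ^- m)%:E)); last first.
    move=> w _; under eq_integral do rewrite EFinM.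
    rewrite ge0_integralZl ?lee_fin//; last first.
      by apply/measurable_EFinP; exact: measurable_indic.
    by rewrite integral_indic// setIT hmu -EFinM.
  rewrite sumEFin -mulr_suml -mulr_sumr limit_form_cells//; congr (_%:E).
  by rewrite expr_div_n exprVn; field; rewrite !expf_neq0 ?pnatr_eq0.
rewrite int_eq in int_le.
rewrite /ip /Rintegral -[leRHS]/(fine _%:E); apply: fine_le => //.
rewrite ge0_fin_numE; first by apply: le_lt_trans int_le _; rewrite ltry.
by apply: integral_ge0 => x _; rewrite lee_fin -expr2 sqr_ge0.
Qed.

Variables (lam : nat -> R) (Phi : nat -> K G -> R).
Hypothesis hPhi : eigenbasis mu lam Phi.

Lemma eigenfunction_L2 j : Phi j \in Lfun mu 2%:E.
Proof.
have [_ h2 _] := eigenfunctionP hPhi j.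
rewrite (_ : Phi j = fun x => - (lam j)^-1 * (- lam j * Phi j x)).
  exact: L2_scale.
apply/funext => x; rewrite mulrA mulrNN mulVf ?mul1r//.
by rewrite gt_eqF// (eigenvalue_gt0 hPhi).
Qed.

Lemma eigenfunction_finite_energy j : finite_energy (Phi j).
Proof. by have [[_ /finite_energyP ]] := eigenfunctionP hPhi j. Qed.

Lemma eigenfunction_form i j : form (Phi i) (Phi j) = lam i * (i == j)%:R.
Proof.
have [_ _ ->] := eigenfunctionP hPhi i; last by have [] := eigenfunctionP hPhi j.
rewrite ip_scale; [|exact: eigenfunction_L2|exact: eigenfunction_L2].
by rewrite (eigenfunction_orthonormal hPhi) mulNr opprK.
Qed.

(** The square is expanded at each finite level and the limit is taken afterwards; orthogonality of
    the eigenfunctions for [form] leaves the diagonal terms. The 3 is the ratio of [limit_form] to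
    [energy]. *)
Lemma combination_energy n (c : 'I_n -> R) (u := fun x => \sum_(j < n) c j * Phi j x) :
  finite_energy u /\ limit_energy u = 3 * \sum_(j < n) lam j * c j ^+ 2.
Proof.
have cv : renorm k u u @[k --> \oo] -->
    \sum_(i < n) \sum_(j < n) c i * c j * (3 * form (Phi i) (Phi j)).
  have -> : (fun k => renorm k u u) = (fun k => \sum_(i < n) \sum_(j < n)
       c i * c j * renorm k (Phi i) (Phi j)).
    apply/funext => k; rewrite /renormalized level_form_sum2 mulr_sumr.
    apply: eq_bigr => i _; rewrite mulr_sumr; apply: eq_bigr => j _.
    by rewrite mulrCA.
  apply: cvg_big => [|i _]; first exact: add_continuous.
  apply: cvg_big => [|j _]; first exact: add_continuous.
  apply: cvgM; first exact: cvg_cst.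
  by apply: renormalized_form_cvg; exact: eigenfunction_finite_energy.
split; last first.
  rewrite /limit_form (cvg_lim _ cv)// mulr_sumr; apply: eq_bigr => i _.
  rewrite (bigD1 i)//= big1 ?addr0; last first.
    move=> j ji; rewrite eigenfunction_form (_ : (i == j :> nat) = false) ?mulr0//.
    by rewrite eq_sym; apply: negbTE.
  by rewrite eigenfunction_form eqxx mulr1 expr2; ring.
exists (limn (fun k => renorm k u u)) => k.
apply: (nondecreasing_cvgn_le (renormalized_nondecreasing fixP junctionP u)).
exact: cvgP cv.
Qed.

Lemma combination_ip n (c : 'I_n -> R) (u := fun x => \sum_(j < n) c j * Phi j x) :
  ip mu u u = \sum_(j < n) c j ^+ 2.
Proof.
have u2 : u \in Lfun mu 2%:E by apply: L2_sum => j; exact: eigenfunction_L2.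
rewrite {1}/u ip_suml//; last by move=> j; exact: eigenfunction_L2.
apply: eq_bigr => i _; rewrite expr2; congr (_ * _).
rewrite ipC /u ip_suml; [|move=> j|]; try exact: eigenfunction_L2.
rewrite (bigD1 i)//= big1 ?addr0; last first.
  move=> j ji; rewrite (eigenfunction_orthonormal hPhi).
  by rewrite (_ : (j == i :> nat) = false) ?mulr0//; exact: negbTE.
by rewrite (eigenfunction_orthonormal hPhi) eqxx mulr1.
Qed.

(** As [lam] is indexed from 0, [lam (3 ^ m)] is the largest of the 3^m + 1 eigenvalues involved.
    The constant is 48 = 16 * 3, with 16 the square of the chaining constant 4 and 3 the ratio of
    [limit_form] to [energy]. *)
Lemma eigenvalue_ge m : 5 ^+ m / 48 <= lam (3 ^ m).
Proof.
pose W := m.-tuple 'I_3; pose n := (3 ^ m).+1.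
have cardW : #|{: W}| = (3 ^ m)%N by rewrite card_tuple card_ord.
(* Rows are eigenfunctions and columns are chosen vertices; with one row more than columns, the left
   kernel is nonzero. *)
pose A : 'M[R]_(n, #|{: W}|) := \matrix_(i, k) Phi i (act (enum_val k : W) (v ord0)).
have : kermx A != 0.
  rewrite kermx_eq0 /row_free; apply: contraTneq (rank_leq_col A) => ->.
  by rewrite cardW -ltnNge.
move=> /rowV0Pn[c /sub_kermxP cA c0].
pose u x := \sum_(j < n) c ord0 j * Phi j x.
have u0 w : u (act (w : W) (v ord0)) = 0.
  have /matrixP/(_ ord0 (enum_rank w)) := cA.
  by rewrite !mxE => <-; apply: eq_bigr => j _; rewrite mxE enum_rankK.
have [uE uL] := combination_energy (fun j => c ord0 j).
have cu : continuous u.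
  apply: continuous_comb => j; exact: (eigenfunction_continuous hPhi).
have := Poincare cu uE u0; rewrite uL combination_ip.
have le : \sum_(j < n) lam j * c ord0 j ^+ 2 <= lam (3 ^ m) * \sum_(j < n) c ord0 j ^+ 2.
  rewrite mulr_sumr; apply: ler_sum => j _; rewrite ler_wpM2r ?sqr_ge0//.
  by apply: (eigenvalue_nondecreasing hPhi); rewrite -ltnS.
have S_gt0 : 0 < \sum_(j < n) c ord0 j ^+ 2.
  rewrite lt_def sumr_ge0 ?andbT; last by move=> j _; exact: sqr_ge0.
  apply: contraNneq c0 => /eqP; rewrite psumr_eq0; last by move=> j _; exact: sqr_ge0.
  move=> /allP z; apply/eqP/rowP => j; rewrite mxE.
  by have := z j (mem_index_enum j); rewrite /= sqrf_eq0 => /eqP.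
move: le S_gt0; set S := \sum_(j < n) c ord0 j ^+ 2; set L := \sum_(j < n) _.
move=> le S_gt0 S_le; rewrite ler_pdivrMr ?ltr0n//.
rewrite -(ler_pM2r S_gt0).
have S_le' : 5 ^+ m * S <= 48 * L.
  rewrite -ler_pdivlMl ?exprn_gt0 ?ltr0n//; apply: le_trans S_le _.
  by rewrite exprVn (_ : 16 * _ * _ = (5 ^+ m)^-1 * (48 * L))//; ring.
by apply: le_trans S_le' _; lra.
Qed.

End eigenvalue_lower_bound.

(** * Convergence of sums of negative powers of the eigenvalues *)

Section spectral_zeta.
Context {R : realType}.
Implicit Types (lam : nat -> R) (b : R).

Lemma powR_exprn (x : R) r n : 0 <= x -> (x ^+ n) `^ r = (x `^ r) ^+ n.
Proof.
move=> x0; rewrite -(powR_mulrn n x0) -(powR_mulrn n (powR_ge0 x r)).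
by rewrite -!powRrM mulrC.
Qed.

Lemma ler_powRN (x y r : R) : 0 < x -> x <= y -> 0 <= r -> y `^ (- r) <= x `^ (- r).
Proof.
move=> x0 xy r0; rewrite !powRN lef_pV2 ?posrE ?powR_gt0//.
  by apply: ge0_ler_powR => //; rewrite nnegrE ltW// (lt_le_trans x0).
exact: lt_le_trans xy.
Qed.

Lemma d_h_d_w : d_h / d_w = ln 3 / ln 5 :> R.
Proof.
have ln_gt0 n : (1 < n)%N -> 0 < ln n%:R :> R by move=> n1; rewrite ln_gt0 ?ltr1n.
have := ln_gt0 2 isT; have := ln_gt0 3 isT; have := ln_gt0 5 isT.
move=> /lt0r_neq0 h5 /lt0r_neq0 h3 /lt0r_neq0 h2; rewrite /d_h /d_w; field.
by rewrite h5 h2.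
Qed.

Lemma spectral_ratio b : d_h / d_w < b -> 0 < b /\ 3 * 5 `^ (- b) < 1 :> R.
Proof.
rewrite d_h_d_w => hb.
have ln5 : 0 < ln 5 :> R by rewrite ln_gt0 ?ltr1n.
have ln3 : 0 < ln 3 :> R by rewrite ln_gt0 ?ltr1n.
split; first by apply: lt_trans hb; rewrite divr_gt0.
rewrite powRN ltr_pdivrMr ?powR_gt0 ?ltr0n// mul1r.
rewrite ltr_pdivrMr// in hb.
rewrite /powR pnatr_eq0 /= -{1}(@lnK _ 3) ?posrE ?ltr0n//.
by rewrite ltr_expR.
Qed.

Lemma spectral_zeta_fin lam b : (forall j, 0 < lam j) ->
  (forall i j, (i <= j)%N -> lam i <= lam j) ->
  (forall m, 5 ^+ m / 48 <= lam (3 ^ m)%N) ->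
  d_h / d_w < b -> (\sum_(0 <= j <oo) (lam j `^ (- b))%:E < +oo)%E.
Proof.
move=> lam0 lam_nd lam_ge /spectral_ratio [b0 q1].
set q := 3 * 5 `^ (- b) in q1.
have q0 : 0 <= q by rewrite mulr_ge0 ?powR_ge0 ?ler0n.
pose C := 48^-1 `^ (- b) : R.
have C0 : 0 <= C by exact: powR_ge0.
(* Blocks of indices from 3^M to 3^(M+1): each has 2 * 3^M terms, at most (5^M / 48)^(-b) = C
   5^(-bM), hence a sum of at most 2 C q^M. The index 0 lies below the first block and is kept
   apart. *)
have bound M : \sum_(0 <= j < 3 ^ M) lam j `^ (- b) <=
    lam 0%N `^ (- b) + 2 * C * \sum_(m < M) q ^+ m.
  elim: M => [|M IH].
    by rewrite expn0 big_nat1 big_ord0 mulr0 addr0.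
  rewrite (@big_cat_nat _ _ _ (3 ^ M)) ?leq_exp2l//= big_ord_recr /= mulrDr addrA.
  apply: lerD => //.
  apply: (@le_trans _ _ (\sum_(3 ^ M <= j < 3 ^ M.+1) (5 ^+ M / 48) `^ (- b))).
    rewrite !big_nat; apply: ler_sum => j /andP[Mj _].
    apply: ler_powRN; [|exact: le_trans (lam_ge M) (lam_nd _ _ Mj)|exact: ltW].
    by rewrite divr_gt0 ?exprn_gt0 ?ltr0n.
  rewrite sumr_const_nat powRM ?exprn_ge0 ?invr_ge0 ?ler0n// powR_exprn ?ler0n//.
  rewrite -/C (_ : (3 ^ M.+1 - 3 ^ M = 2 * 3 ^ M)%N); last first.
    by rewrite expnS -{2}[(3 ^ M)%N]mul1n -mulnBl.
  rewrite -[leLHS]mulr_natl natrM natrX /q exprMn.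
  by rewrite (_ : 2%:R * 3%:R ^+ M * _ = 2 * C * (3 ^+ M * (5 `^ (- b)) ^+ M)) //; ring.
pose B := lam 0%N `^ (- b) + 2 * C * (1 - q)^-1.
apply: (@le_lt_trans _ _ B%:E); last by rewrite ltry.
apply: lime_le; first by apply: is_cvg_nneseries => n _ _; rewrite lee_fin powR_ge0.
apply: nearW => n; rewrite sumEFin lee_fin.
apply: (@le_trans _ _ (\sum_(0 <= j < 3 ^ n) lam j `^ (- b))).
  rewrite [leRHS](@big_cat_nat _ _ _ n) ?(ltnW (ltn_expl _ _))//= lerDl.
  by apply: sumr_ge0 => i _; exact: powR_ge0.
apply: le_trans (bound n) _; rewrite lerD2l ler_wpM2l ?mulr_ge0//.
have := subrX1 q n => /(congr1 -%R); rewrite opprB -mulNr opprB => e.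
rewrite -[leRHS]mul1r ler_pdivlMr ?subr_gt0// mulrC -e.
by rewrite gerBl exprn_ge0.
Qed.

End spectral_zeta.

(** * Square-integrable functions *)

Section L2_norm.
Context {R : realType} (G : gasket R) (mu : {measure set (K G) -> \bar R}).
Implicit Types f g h : K G -> R.

Lemma L2_measurable f : f \in Lfun mu 2%:E -> measurable_fun setT f.
Proof. by rewrite inE => /andP[]; rewrite inE. Qed.

Lemma L2norm_ge0 f : (0 <= L2norm mu f)%E.
Proof. exact: Lnorm_ge0. Qed.

Lemma L2norm_fin f : f \in Lfun mu 2%:E -> L2norm mu f \is a fin_num.
Proof.
rewrite inE => /andP[_]; rewrite inE /= /finite_norm => fin.
by rewrite ge0_fin_numE ?L2norm_ge0.
Qed.

Lemma L2normB f g : L2norm mu (fun x => f x - g x) = L2norm mu (fun x => g x - f x).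
Proof.
rewrite /L2norm -oppe_Lnorm; apply: eq_Lnorm => x /=.
by congr (_%:E); exact: opprB.
Qed.

Lemma L2norm_triangle f g : measurable_fun setT f -> measurable_fun setT g ->
  (L2norm mu (fun x => f x + g x)%R <= L2norm mu f + L2norm mu g)%E.
Proof. by move=> mf mg; apply: eminkowski => //; rewrite lee_fin ler1n. Qed.

Lemma L2norm_triangleB f g h : measurable_fun setT f -> measurable_fun setT g ->
  measurable_fun setT h ->
  (L2norm mu (fun x => f x - h x)%R <=
   L2norm mu (fun x => f x - g x)%R + L2norm mu (fun x => g x - h x)%R)%E.
Proof.
move=> mf mg mh; rewrite (_ : (fun x => f x - h x) =
  fun x => (f x - g x) + (g x - h x)).
  by apply: L2norm_triangle; apply: measurable_funB.
by apply/funext => x; rewrite subrKA.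
Qed.

Lemma L2norm_sqr f : f \in Lfun mu 2%:E -> (fine (L2norm mu f)) ^+ 2 = ip mu f f.
Proof.
move=> f2; have /esym e : ('N[mu]_2%:E[EFin \o f] `^ 2 = \int[mu]_x (f x * f x)%:E)%E.
  rewrite powR_Lnorm//; apply: eq_integral => x _ /=.
  by rewrite (powR_mulrn 2 (normr_ge0 _)) real_normK ?num_real// expr2.
rewrite /ip /Rintegral e -[Lnorm _ _ _]/(L2norm mu f).
rewrite -[in RHS](fineK (L2norm_fin f2)) /= -powR_mulrn//.
by rewrite fine_ge0// L2norm_ge0.
Qed.

(** [laplacian_pow] picks an arbitrary representative of an L^2 limit; this transfers inner products
    to a convenient one. *)
Lemma L2norm_eq0_ip f g : f \in Lfun mu 2%:E -> g \in Lfun mu 2%:E ->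
  L2norm mu (fun x => f x - g x) = 0%E -> ip mu f f = ip mu g g.
Proof.
move=> f2 g2 fg0.
have le h k : h \in Lfun mu 2%:E -> k \in Lfun mu 2%:E ->
    L2norm mu (fun x => h x - k x) = 0%E -> (L2norm mu h <= L2norm mu k)%E.
  move=> h2 k2 hk; rewrite (_ : h = fun x => (h x - k x) + k x); last first.
    by apply/funext => x; rewrite subrK.
  apply: le_trans (L2norm_triangle (L2_measurable (L2B h2 k2)) (L2_measurable k2)) _.
  by rewrite hk add0e.
rewrite -!L2norm_sqr//; congr (fine _ ^+ 2); apply/eqP.
by rewrite eq_le !le// L2normB.
Qed.

End L2_norm.

(** * Compactness of the gasket and boundedness of continuous functions *)

Section continuous_functions.
Context {R : realType} (G : gasket R) (mu : {measure set (K G) -> \bar R}).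
Hypothesis hmu : selfsimilar_measure mu.

Lemma gasket_compact : compact [set: K G].
Proof.
move=> F FF _.
pose F' : set_system (plane R) := (val : K G -> plane R) @ F.
have F'c : F' (carrier G).
  by rewrite /F' /fmap /=; apply: filterS filterT => x _; exact: set_mem (valP x).
have F'F : ProperFilter F' by exact: fmap_proper_filter.
have [z [Gz zF]] := @carrier_compact _ G F' F'F F'c.
exists (exist _ z (mem_set Gz)); split=> // A B FA [B' [[W oW <-] Wz] sub].
have : F' (val @` A) by rewrite /F' /fmap /=; apply: filterS FA => x Ax; exists x.
have Wnz : nbhs z W by exact: open_nbhs_nbhs.
move=> /zF /(_ Wnz) [_ [[y Ay <-] Wy]].
by exists y; split => //; exact: sub.
Qed.

Lemma continuous_bounded (f : K G -> R) : continuous f ->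
  exists M, forall x, `|f x| <= M.
Proof.
move=> cf; have : compact (f @` [set: K G]).
  by apply: continuous_compact gasket_compact; exact: continuous_subspaceT.
move=> /compact_bounded[M [_ HM]]; exists (M + 1) => x.
by apply: (HM (M + 1)); [rewrite ltrDl|exists x].
Qed.

Lemma continuous_L2 (f : K G -> R) : continuous f -> f \in Lfun mu 2%:E.
Proof.
move=> cf; have mf := continuous_measurable cf.
have [M HM] := continuous_bounded cf.
rewrite inE; apply/andP; split; rewrite inE//= /finite_norm unlock /=.
rewrite poweR_lty//; apply: (@le_lt_trans _ _ (\int[mu]_x (cst (M `^ 2)%:E x))%E).
  apply: ge0_le_integral => //=.
  - apply/measurable_EFinP; apply: (@measurableT_comp _ _ _ _ _ _ (@powR R ^~ 2)) => //.
    exact: measurableT_comp.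
  - by move=> x _; rewrite lee_fin ge0_ler_powR// ?nnegrE// (le_trans _ (HM x)).
by rewrite integral_cst// (selfsimilar_setT hmu) mule1 ltry.
Qed.

End continuous_functions.

(** * Eigenfunction expansion of distributions *)

Section spectral_expansion.
Context {R : realType} (G : gasket R) (mu : {measure set (K G) -> \bar R}).
Hypothesis hmu : selfsimilar_measure mu.
Variables (lam : nat -> R) (Phi : nat -> K G -> R).
Hypothesis hPhi : eigenbasis mu lam Phi.
Implicit Types f g h : K G -> R.
Local Notation L2 := (Lfun mu 2%:E).
Local Notation schwartz := (schwartz mu Phi).

Let Phi_L2 j : Phi j \in L2 := eigenfunction_L2 hPhi j.

Lemma schwartz_L2 f : schwartz f -> f \in L2.
Proof. by case=> cf _ _; exact: continuous_L2. Qed.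

Lemma ip_eigenfunction_comb n (c : nat -> R) i :
  ip mu (Phi i) (fun x => \sum_(j < n) c j * Phi j x) = if (i < n)%N then c i else 0.
Proof.
rewrite ipC ip_suml// -(big_mkord xpredT (fun j => c j * ip mu (Phi j) (Phi i))).
case: ifPn => [i_n|]; last first.
  rewrite -leqNgt => ni; rewrite big_nat big1// => j /andP[_ jn].
  rewrite (eigenfunction_orthonormal hPhi) (_ : (j == i) = false) ?mulr0//.
  by rewrite ltn_eqF// (leq_trans jn).
rewrite (bigD1_seq i) ?mem_index_iota ?iota_uniq//= big1 ?addr0.
  by rewrite (eigenfunction_orthonormal hPhi) eqxx mulr1.
by move=> j ji; rewrite (eigenfunction_orthonormal hPhi) (negbTE ji) mulr0.
Qed.

Lemma schwartz_comb n (c : nat -> R) :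
  schwartz (fun x => \sum_(j < n) c j * Phi j x).
Proof.
split.
- apply: continuous_comb => j; exact: (eigenfunction_continuous hPhi).
- move=> x bx; rewrite big1// => j _.
  have [[_ _ v] _ _] := eigenfunctionP hPhi j.
  by rewrite v ?mulr0.
- move=> k; apply: cvg_near_cst; exists n => // j /= nj.
  by rewrite ip_eigenfunction_comb ltnNge nj /= normr0 mulr0.
Qed.

Lemma schwartz_eigenfunction j : schwartz (Phi j).
Proof.
have := schwartz_comb j.+1 (fun i => (i == j)%:R).
congr schwartz; apply/funext => x; rewrite big_ord_recr /= eqxx mul1r big1 ?add0r//.
by move=> i _; rewrite ltn_eqF ?mul0r.
Qed.

Lemma linear_on_comb (T : (K G -> R) -> R) n (c : nat -> R) : linear_on schwartz T ->
  T (fun x => \sum_(j < n) c j * Phi j x) = \sum_(j < n) c j * T (Phi j).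
Proof.
move=> linT; elim: n => [|n IH].
  (* Linearity makes the value at the empty sum equal to twice itself, hence zero. *)
  have := linT 1 _ _ (schwartz_comb 0 c) (schwartz_comb 0 c).
  have -> : (fun x => 1 * \sum_(j < 0) c j * Phi j x + \sum_(j < 0) c j * Phi j x) =
      fun x => \sum_(j < 0) c j * Phi j x.
    by apply/funext => x; rewrite !big_ord0 mulr0 addr0.
  by rewrite big_ord0 mul1r => /eqP; rewrite addrC -subr_eq subrr eq_sym => /eqP.
rewrite big_ord_recr /= -IH addrC.
have := linT (c n) _ _ (schwartz_eigenfunction n) (schwartz_comb n c).
by rewrite addrC => <-; congr T; apply/funext => x; rewrite big_ord_recr /= addrC.
Qed.

Definition spectral_sum (r : R) f n : K G -> R :=
  fun x => \sum_(j < n) lam j `^ r * ip mu (Phi j) f * Phi j x.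

Definition projection n f : K G -> R :=
  fun x => \sum_(j < n) ip mu (Phi j) f * Phi j x.

Lemma spectral_sum_L2 r f n : spectral_sum r f n \in L2.
Proof. exact: L2_sum. Qed.

Lemma projection_L2 n f : projection n f \in L2.
Proof. exact: L2_sum. Qed.

(** Subtracting f cancels the coefficients of index below N and leaves the opposites of the
    others. *)
Lemma spectral_sum_tail r f N n : f \in L2 -> (N <= n)%N ->
  spectral_sum r (fun x => projection N f x - f x) n =
  fun x => spectral_sum r f N x - spectral_sum r f n x.
Proof.
move=> f2 Nn; apply/funext => x; rewrite /spectral_sum.
have -> : \sum_(j < N) lam j `^ r * ip mu (Phi j) f * Phi j x =
    \sum_(j < n) (if (j < N)%N then lam j `^ r * ip mu (Phi j) f * Phi j x else 0).
  by rewrite -big_mkcond /= (big_ord_widen _ (fun j => lam j `^ r * ip mu (Phi j) f * Phi j x) Nn).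
rewrite -sumrB; apply: eq_bigr => j _.
rewrite ipC ipBl ?projection_L2// 2!(ipC _ _ (Phi j)).
rewrite (ip_eigenfunction_comb N (fun j => ip mu (Phi j) f)).
by case: ifP => _; ring.
Qed.

(* No growth of the eigenvalues is needed: if the series of the k-th power of the
   Laplacian diverges at f, it also diverges at every tail of the expansion of f,
   whose k-th norm is then the junk value 0. *)
Lemma schwartz_norm_tail k f (d : R) : f \in L2 -> 0 < d ->
  \forall N \near \oo, schwartz_norm mu lam Phi k (fun x => projection N f x - f x) < d.
Proof.
move=> f2 d0; set r : R := k%:R.
have d3 : (0 < (d / 3)%:E)%E by rewrite lte_fin divr_gt0.
have nearly u h : L2cvg mu u h ->
    \forall n \near \oo, (L2norm mu (fun x => u n x - h x)%R < (d / 3)%:E)%E.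
  by move=> uh; have /uh : nbhs 0%E (fun y => y < (d / 3)%:E)%E by exact: open_ereal_lt'.
pose S := spectral_sum r f.
pose T N := spectral_sum r (fun x => projection N f x - f x).
have mS n : measurable_fun setT (S n) by apply: L2_measurable; exact: spectral_sum_L2.
have [[h [h2 Sh]]|noh] := pselect (exists h, h \in L2 /\ L2cvg mu S h).
  have mh := L2_measurable h2.
  near=> N.
  have SN : (L2norm mu (fun x => S N x - h x)%R < (d / 3)%:E)%E by near: N; exact: nearly.
  rewrite /schwartz_norm /laplacian_pow; set P := [set _ | _].
  have [|g2 gT] := @xgetPex _ (cst 0) P.
    (* For n >= N, [T N n] is [S N - S n], which converges to [S N - h]. *)
    exists (fun x => S N x - h x); split; first by apply: L2B => //; exact: spectral_sum_L2.
    have e n : (N <= n)%N -> L2norm mu (fun x => S n x - h x) =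
        L2norm mu (fun x => T N n x - (S N x - h x)).
      move=> Nn; rewrite /T spectral_sum_tail// L2normB.
      by apply: eq_Lnorm => x /=; congr (_%:E); rewrite /S; ring.
    by apply: cvg_trans (Sh); apply: near_eq_cvg; exists N.
  move: (xget _ _) g2 gT => g g2 gT.
  have mg := L2_measurable g2.
  suff : (L2norm mu g < d%:E)%E.
    by rewrite -[L2norm mu g]fineK ?L2norm_fin// lte_fin.
  (* The chosen g is only known as some limit of [T N]. At one common index n >= N its norm is at
     most |g - T N n| + |S N - h| + |h - S n|, each below d / 3. *)
  have [n [Sn [Tn Nn]]] :=
    filter_ex (filterI (nearly _ _ Sh) (filterI (nearly _ _ gT) (nbhs_infty_ge N))).
  have mT : measurable_fun setT (T N n) by apply: L2_measurable; exact: spectral_sum_L2.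
  have -> : g = fun x => (g x - T N n x) + T N n x by apply/funext => x; rewrite subrK.
  apply: le_lt_trans (L2norm_triangle mu (measurable_funB mg mT) mT) _.
  rewrite L2normB.
  have TE : T N n = fun x => S N x - S n x by exact: spectral_sum_tail.
  have := L2norm_triangleB mu (mS N) mh (mS n); rewrite -TE (L2normB _ h) => T_le.
  apply: le_lt_trans (leeD2l _ T_le) _.
  rewrite (_ : d%:E = (d / 3)%:E + ((d / 3)%:E + (d / 3)%:E))%E; last first.
    by rewrite -!EFinD; congr (_%:E); field.
  by rewrite !lteD.
apply: nearW => N; rewrite /schwartz_norm /laplacian_pow xgetPN.
  by rewrite /L2norm (_ : EFin \o cst 0 = cst 0%E)// Lnorm0.
move=> g [g2 Tg]; apply: noh; exists (fun x => S N x - g x); split.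
  by apply: L2B => //; exact: spectral_sum_L2.
have e n : (N <= n)%N -> L2norm mu (fun x => T N n x - g x) =
    L2norm mu (fun x => S n x - (S N x - g x)).
  move=> Nn; rewrite /T spectral_sum_tail// L2normB.
  by apply: eq_Lnorm => x /=; congr (_%:E); rewrite /S; ring.
by apply: cvg_trans (Tg); apply: near_eq_cvg; exists N.
Unshelve. all: by end_near. Qed.

(** The partial sums are the values of T at the projections of f, and these converge to f in each of
    the finitely many norms that control T near f. *)
Lemma distribution_expansion (T : (K G -> R) -> R) f :
  schwartz_dual mu lam Phi T -> schwartz f ->
  series (fun j => T (Phi j) * ip mu (Phi j) f) @ \oo --> T f.
Proof.
move=> [linT contT] Sf; apply/cvgrPdist_lt => e e0.
have [n [d [d0 H]]] := contT f Sf e e0.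
have : \forall N \near \oo, forall k, (k < n)%N ->
    schwartz_norm mu lam Phi k (fun x => projection N f x - f x) < d.
  elim: n {H} => [|n IH]; first exact: nearW.
  have := schwartz_norm_tail n (schwartz_L2 Sf) d0.
  move: IH; apply: filterS2 => N H1 H2 k.
  by rewrite ltnS leq_eqVlt => /predU1P[->|/H1].
apply: filterS => N /(H _ (schwartz_comb N (fun j => ip mu (Phi j) f))).
rewrite distrC (linear_on_comb N (fun j => ip mu (Phi j) f) linT) /series /= big_mkord.
by under eq_bigr do rewrite mulrC.
Qed.

End spectral_expansion.

(** * Pairings of weighted square-summable sequences *)

Section weighted_pairing.
Context {R : realType}.
Implicit Types u a b : nat -> R.

Lemma partial_sum_le u n : (forall j, 0 <= u j) ->
  (\sum_(0 <= j <oo) (u j)%:E < +oo)%E ->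
  \sum_(0 <= j < n) u j <= fine (\sum_(0 <= j <oo) (u j)%:E)%E.
Proof.
move=> u0 fin; rewrite -lee_fin fineK.
  by rewrite -sumEFin; apply: nneseries_lim_ge => j _ _; rewrite lee_fin.
by rewrite ge0_fin_numE// nneseries_ge0// => j _ _; rewrite lee_fin.
Qed.

Lemma nneseries_cvgn u : (forall j, 0 <= u j) ->
  (\sum_(0 <= j <oo) (u j)%:E < +oo)%E -> cvgn (series u).
Proof.
move=> u0 fin; apply: nondecreasing_is_cvgn.
  by apply/nondecreasing_seqP => n; rewrite /series /= big_nat_recr//= lerDl.
by exists (fine (\sum_(0 <= j <oo) (u j)%:E)%E) => _ [n _ <-]; exact: partial_sum_le.
Qed.

(** The arithmetic-geometric inequality, with a free parameter t, stands in for Cauchy-Schwarz: it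
    bounds the terms one by one and avoids square roots. A suitable t then makes the bound as small
    as continuity demands. *)
Lemma weighted_pairing (l a b : nat -> R) (alpha : R)
    (A := (\sum_(0 <= j <oo) (l j `^ (- alpha) * a j ^+ 2)%:E)%E)
    (B := (\sum_(0 <= j <oo) (l j `^ alpha * b j ^+ 2)%:E)%E) :
  (forall j, 0 < l j) -> (A < +oo)%E -> (B < +oo)%E ->
  cvgn (series (fun j => a j * b j)) /\
  forall t, 0 < t ->
    `|limn (series (fun j => a j * b j))| <= (t * fine A + fine B / t) / 2.
Proof.
move=> l0 finA finB; set u := fun j => a j * b j.
have A0 j : 0 <= l j `^ (- alpha) * a j ^+ 2 by rewrite mulr_ge0 ?powR_ge0 ?sqr_ge0.
have B0 j : 0 <= l j `^ alpha * b j ^+ 2 by rewrite mulr_ge0 ?powR_ge0 ?sqr_ge0.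
have le t n : 0 < t -> \sum_(0 <= j < n) `|u j| <= (t * fine A + fine B / t) / 2.
  move=> t0; apply: (@le_trans _ _ ((t * (\sum_(0 <= j < n) l j `^ (- alpha) * a j ^+ 2) +
      (\sum_(0 <= j < n) l j `^ alpha * b j ^+ 2) / t) / 2)).
    rewrite mulr_sumr mulr_suml -big_split mulr_suml /=; apply: ler_sum => j _.
    set p := l j `^ alpha; have p0 : 0 < p by rewrite powR_gt0.
    rewrite powRN -/p /u normrM -(real_normK (num_real (a j))) -(real_normK (num_real (b j))).
    move: `|a j| `|b j| => x y; rewrite -subr_ge0.
    have -> : (t * (p^-1 * x ^+ 2) + p * y ^+ 2 / t) / 2 - x * y =
        (t * x - p * y) ^+ 2 / (2 * p * t).
      by field; rewrite !gt_eqF.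
    by rewrite divr_ge0 ?sqr_ge0// !mulr_ge0// ltW.
  rewrite ler_pM2r ?invr_gt0 ?ltr0n// lerD//.
    by rewrite ler_pM2l//; exact: partial_sum_le.
  by rewrite ler_pM2r ?invr_gt0//; exact: partial_sum_le.
have cn : cvgn [normed series u].
  apply: nondecreasing_is_cvgn.
    apply/nondecreasing_seqP => n.
    by rewrite -[leRHS]/(\sum_(0 <= k < n.+1) `|u k|) big_nat_recr//= lerDl.
  by exists ((1 * fine A + fine B / 1) / 2) => _ [n _ <-]; exact: le.
split=> [|t t0]; first exact: normed_cvg.
apply: le_trans (lim_series_norm cn) _.
by apply: limr_le => //; apply: nearW => n; exact: le.
Qed.

End weighted_pairing.

(** * Functionals on Sobolev spaces and powers of the Laplacian *)

Section duality.
Context {R : realType} (G : gasket R) (mu : {measure set (K G) -> \bar R}).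
Hypothesis hmu : selfsimilar_measure mu.
Variables (lam : nat -> R) (Phi : nat -> K G -> R).
Hypothesis hPhi : eigenbasis mu lam Phi.
Local Notation L2 := (Lfun mu 2%:E).
Let lam_gt0 := eigenvalue_gt0 hPhi.
Let Phi_L2 j : Phi j \in L2 := eigenfunction_L2 hPhi j.

Lemma sobolev_norm2E alpha f : sobolev_norm2 mu lam Phi alpha f =
  (\sum_(0 <= j <oo) (lam j `^ alpha * ip mu (Phi j) f ^+ 2)%:E)%E.
Proof. by apply: eq_eseriesr => j _; rewrite ipC. Qed.

(* The extension of T to the Sobolev space is its eigenfunction expansion. On a
   Schwartz function the expansion converges by continuity of T, on a function of
   finite Sobolev norm by Cauchy-Schwarz, and any element of the Sobolev space is
   a difference of two such functions. *)
Lemma sobolev_dual_of_expansion alpha (T : (K G -> R) -> R) :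
  schwartz_dual mu lam Phi T ->
  (\sum_(0 <= j <oo) (lam j `^ (- alpha) * T (Phi j) ^+ 2)%:E < +oo)%E ->
  sobolev_dual mu lam Phi alpha T.
Proof.
move=> dT finA; split=> //.
pose e f := series (fun j => T (Phi j) * ip mu (Phi j) f).
have e_comb c f g : f \in L2 -> g \in L2 ->
    e (fun x => c * f x + g x) = (fun n => c * e f n + e g n).
  move=> f2 g2; apply/funext => n; rewrite /e /series /= mulr_sumr -big_split /=.
  by apply: eq_bigr => j _; rewrite ipC ip_comb// !(ipC mu _ (Phi j)); ring.
have eB f g : f \in L2 -> g \in L2 -> e (fun x => g x - f x) = (fun n => e g n - e f n).
  move=> f2 g2; rewrite (_ : (fun x => _) = fun x => - 1 * f x + g x).
    by rewrite e_comb//; apply/funext => n; rewrite mulN1r addrC.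
  by apply/funext => x; rewrite mulN1r addrC.
have e_fin f : (sobolev_norm2 mu lam Phi alpha f < +oo)%E -> cvgn (e f).
  rewrite sobolev_norm2E => finB.
  by have [] := weighted_pairing lam_gt0 finA finB.
have sob_L2 f : sobolev mu lam Phi alpha f -> f \in L2 by case.
have e_cvg f : sobolev mu lam Phi alpha f -> cvgn (e f).
  move=> [f2 /(_ 1 ltr01)[g Sg gf]].
  have -> : e f = (fun n => e g n - e (fun x => g x - f x) n).
    by apply/funext => n; rewrite eB// ?(schwartz_L2 hmu Sg)// subKr.
  apply: is_cvgB; first exact: cvgP (distribution_expansion hmu hPhi dT Sg).
  by apply: e_fin; apply: lt_trans gf _; rewrite ltry.
exists (fun f => limn (e f)); split.
- move=> c f g sf sg; rewrite e_comb ?sob_L2//; apply: cvg_lim => //.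
  by apply: cvgD; [apply: cvgM; [exact: cvg_cst|exact: e_cvg]|exact: e_cvg].
- move=> f sf eps eps0.
  set A := (\sum_(0 <= j <oo) _)%E in finA.
  have A0 : 0 <= fine A.
    rewrite fine_ge0// nneseries_ge0// => j _ _.
    by rewrite lee_fin mulr_ge0 ?powR_ge0 ?sqr_ge0.
  (* Then t A <= eps, the added 1 covering the case A = 0, and a squared distance B < t * eps gives
     B / t < eps; the mean of the two is below eps. *)
  pose t := eps / (fine A + 1).
  have t0 : 0 < t by rewrite divr_gt0// ltr_wpDl.
  exists (t * eps); split=> [|g sg dist]; first by rewrite mulr_gt0.
  have -> : limn (e g) - limn (e f) = limn (e (fun x => g x - f x)).
    by rewrite eB ?sob_L2// limB//; exact: e_cvg.
  have dist_fin : (sobolev_norm2 mu lam Phi alpha (fun x => (g x - f x)%R) < +oo)%E.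
    by apply: lt_trans dist _; rewrite ltry.
  rewrite sobolev_norm2E in dist dist_fin.
  have [_ /(_ t t0)] := weighted_pairing lam_gt0 finA dist_fin.
  move=> /le_lt_trans; apply; rewrite ltr_pdivrMr ?ltr0n// mulr_natr mulr2n.
  apply: ler_ltD.
    rewrite /t -mulrA ger_pMr// mulrC ler_pdivrMr ?ltr_wpDl// mul1r.
    by rewrite lerDl.
  rewrite ltr_pdivrMr// mulrC -lte_fin fineK//.
  rewrite ge0_fin_numE// nneseries_ge0// => j _ _.
  by rewrite lee_fin mulr_ge0 ?powR_ge0 ?sqr_ge0.
- move=> f Sf; apply/esym/cvg_lim => //.
  exact: (distribution_expansion hmu hPhi dT Sf).
Qed.

(** The spectral sums are stationary from index j + 1 on, so the chosen representative is at L^2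
    distance 0 from [lam j] to the power r times [Phi j]. *)
Lemma laplacian_pow_eigenfunction r j :
  ip mu (laplacian_pow mu lam Phi r (Phi j)) (laplacian_pow mu lam Phi r (Phi j)) =
  lam j `^ (2 * r).
Proof.
pose g x := lam j `^ r * Phi j x.
have g2 : g \in L2 by exact: L2_scale.
have sum_g n : (j < n)%N -> spectral_sum mu lam Phi r (Phi j) n = g.
  move=> jn; apply/funext => x; rewrite /spectral_sum.
  rewrite -(big_mkord xpredT (fun i => lam i `^ r * ip mu (Phi i) (Phi j) * Phi i x)).
  rewrite (bigD1_seq j) ?mem_index_iota ?iota_uniq//= big1 ?addr0.
    by rewrite (eigenfunction_orthonormal hPhi) eqxx mulr1.
  by move=> i ij; rewrite (eigenfunction_orthonormal hPhi) (negbTE ij) mulr0 mul0r.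
have norm0 : L2norm mu (fun=> 0) = 0%E.
  by rewrite /L2norm (_ : EFin \o (fun=> 0) = cst 0%E)// Lnorm0.
rewrite /laplacian_pow; set P := [set _ | _].
have [|h2 hS] := @xgetPex _ (cst 0) P.
  exists g; split=> //; apply: cvg_near_cst; exists j.+1 => // n /= jn.
  rewrite -[X in (fun x => X x - _)]/(spectral_sum mu lam Phi r (Phi j) n) sum_g//.
  by rewrite -[RHS]norm0; congr L2norm; apply/funext => x; rewrite subrr.
move: (xget _ _) h2 hS => h h2 hS.
have gh0 : L2norm mu (fun x => g x - h x) = 0%E.
  apply: (cvg_unique _ _ hS) => //; apply: cvg_near_cst; exists j.+1 => // n /= jn.
  by rewrite -[X in (fun x => X x - _)]/(spectral_sum mu lam Phi r (Phi j) n) sum_g.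
rewrite -(L2norm_eq0_ip g2 h2 gh0) ip_scale// ipC ip_scale//.
rewrite (eigenfunction_orthonormal hPhi) eqxx mulr1 -powRD//.
  by rewrite mulr2n mulrDl mul1r.
by rewrite (gt_eqF (lam_gt0 j)) implybT.
Qed.

End duality.

(** * The fractional Gaussian field *)

Section fractional_field.
Context {R : realType} (G : gasket R) (mu : {measure set (K G) -> \bar R}).
Hypothesis hmu : selfsimilar_measure mu.
Variables (lam : nat -> R) (Phi : nat -> K G -> R).
Hypothesis hPhi : eigenbasis mu lam Phi.
Context (dO : measure_display) (Omega : measurableType dO) (P : probability Omega R).
Variables (s : R) (X : Omega -> (K G -> R) -> R).
Hypothesis hX : FGF mu lam Phi P s X.
Let lam_gt0 := eigenvalue_gt0 hPhi.

Lemma FGF_coefficient_measurable j : measurable_fun setT (fun w => X w (Phi j)).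
Proof. by have [] := FGF_gaussian hX (schwartz_eigenfunction hPhi j). Qed.

Lemma FGF_coefficient_sqr j :
  (\int[P]_w ((X w (Phi j)) ^+ 2)%:E = (lam j `^ (- (2 * s)))%:E)%E.
Proof.
have Sj := schwartz_eigenfunction hPhi j.
have := FGF_covariance hX Sj Sj; rewrite unlock laplacian_pow_eigenfunction// mulrN => <-.
by apply: eq_integral => w _; rewrite expr2.
Qed.

Lemma FGF_expansion_ae alpha : d_h / d_w - 2 * s < alpha ->
  {ae P, forall w,
    (\sum_(0 <= j <oo) (lam j `^ (- alpha) * X w (Phi j) ^+ 2)%:E < +oo)%E}.
Proof.
move=> halpha.
pose u j w : \bar R := (lam j `^ (- alpha) * X w (Phi j) ^+ 2)%:E.
have u0 j w : (0 <= u j w)%E by rewrite lee_fin mulr_ge0 ?powR_ge0 ?sqr_ge0.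
have mX2 j : measurable_fun setT (fun w => X w (Phi j) ^+ 2).
  by apply: measurable_funX; exact: FGF_coefficient_measurable.
have mu_ j : measurable_fun setT (u j).
  by apply/measurable_EFinP; apply: measurable_funM.
have int_fin : (\int[P]_w (\sum_(0 <= j <oo) u j w) < +oo)%E.
  rewrite integral_nneseries//.
  rewrite (_ : (\sum_(0 <= j <oo) _)%E =
      (\sum_(0 <= j <oo) (lam j `^ (- (alpha + 2 * s)))%:E)%E).
    apply: spectral_zeta_fin => //; last by rewrite -ltrBlDr.
      exact: (eigenvalue_nondecreasing hPhi).
    exact: eigenvalue_ge hmu _ _ hPhi.
  apply: eq_eseriesr => j _; rewrite /u; under eq_integral do rewrite EFinM.
  rewrite ge0_integralZl ?lee_fin ?powR_ge0//; last 2 first.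
  - exact/measurable_EFinP.
  - by move=> w _; rewrite lee_fin sqr_ge0.
  rewrite FGF_coefficient_sqr -EFinM opprD powRD//.
  by rewrite (gt_eqF (lam_gt0 j)) implybT.
have int : P.-integrable setT (fun w => \sum_(0 <= j <oo) u j w)%E.
  apply/integrableP; split; first exact: ge0_emeasurable_sum.
  under eq_integral do rewrite gee0_abs ?nneseries_ge0//.
  exact: int_fin.
have := integrable_ae measurableT int; apply: filterS => w /(_ I).
by rewrite ge0_fin_numE ?nneseries_ge0.
Qed.

(** The uncountably many exponents are reduced to the critical one plus 1/(k+1): the null sets of
    this sequence have a null union, and convergence at one exponent implies convergence at every
    larger one. *)
Lemma FGF_expansion_ae_forall :
  {ae P, forall w, forall alpha, d_h / d_w - 2 * s < alpha ->
    (\sum_(0 <= j <oo) (lam j `^ (- alpha) * X w (Phi j) ^+ 2)%:E < +oo)%E}.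
Proof.
pose a0 : R := d_h / d_w - 2 * s.
have : {ae P, forall w, forall k : nat,
    (\sum_(0 <= j <oo) (lam j `^ (- (a0 + k.+1%:R^-1)) * X w (Phi j) ^+ 2)%:E < +oo)%E}.
  by apply: ae_foralln => k; apply: FGF_expansion_ae; rewrite ltrDl invr_gt0.
apply: filterS => w fin alpha a0_alpha.
have [k ka] : exists k, a0 + k.+1%:R^-1 < alpha.
  have d0 : 0 < alpha - a0 by rewrite subr_gt0.
  have [k _] := near_infty_natSinv_lt (PosNum d0).
  move=> /(_ k (leqnn k)) /=; exists k; rewrite addrC -ltrBrDr//.
set b := a0 + _ in ka.
(* Eigenvalues may be below 1, so increasing the exponent can increase a term, but by no more than
   the factor attached to the least eigenvalue [lam 0]. *)
apply: (@le_lt_trans _ _ (\sum_(0 <= j <oo) ((lam 0%N `^ (- (alpha - b)))%:E *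
    (lam j `^ (- b) * X w (Phi j) ^+ 2)%:E))%E).
  apply: lee_nneseries => j _ //.
    by rewrite lee_fin mulr_ge0 ?powR_ge0 ?sqr_ge0.
  rewrite -EFinM lee_fin [leRHS]mulrA ler_wpM2r ?sqr_ge0//.
  rewrite -[in leLHS](subrK b alpha) opprD powRD; last first.
    by rewrite (gt_eqF (lam_gt0 j)) implybT.
  rewrite ler_wpM2r ?powR_ge0// ler_powRN ?subr_ge0 ?(ltW ka)//.
  exact: (eigenvalue_nondecreasing hPhi).
rewrite nneseriesZl; last by move=> j _; rewrite lee_fin mulr_ge0 ?powR_ge0 ?sqr_ge0.
by rewrite lte_mul_pinfty ?lee_fin ?powR_ge0//; exact: fin.
Qed.

End fractional_field.

Theorem proposition3p2 (R : realType) (G : gasket R)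
    (mu : {measure set (K G) -> \bar R}) (hmu : selfsimilar_measure mu)
    (lam : nat -> R) (Phi : nat -> K G -> R) (hPhi : eigenbasis mu lam Phi)
    (dO : measure_display) (Omega : measurableType dO)
    (P : probability Omega R)
    (s : R) (s_ge0 : 0 <= s) (s_le : s <= d_h / (2 * d_w))
    (X : Omega -> (K G -> R) -> R) (hX : FGF mu lam Phi P s X) :
  {ae P, forall w, forall alpha : R, d_h / d_w - 2 * s < alpha ->
    sobolev_dual mu lam Phi alpha (X w)} /\
  (forall alpha : R, d_h / d_w - 2 * s < alpha ->
    {ae P, forall w,
      cvgn (series (fun j => lam j `^ (- alpha) * (X w (Phi j)) ^+ 2))}).
Proof.
split=> [|alpha halpha].
  have := FGF_expansion_ae_forall hmu hPhi hX; apply: filterS => w fin alpha /fin.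
  by apply: (sobolev_dual_of_expansion hmu hPhi); exact: (FGF_dual hX).
have := FGF_expansion_ae hmu hPhi hX halpha; apply: filterS => w.
apply: nneseries_cvgn => j.
by rewrite mulr_ge0 ?powR_ge0 ?sqr_ge0.
Qed.
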